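(* Let $P\to M$ be a $GN$-structure on an $n$-dimensional smooth manifold $M$. The collection $\mathcal{M}$ of metrics belonging to $P$ is a non-empty affine space with respect to covariant symmetric rank $2$ tensors of type $III$. That is, $\mathcal{M}\neq\emptyset$; if $g\in\mathcal{M}$ and $T$ is a symmetric covariant $2$-tensor field of type $III$, then $g+T\in\mathcal{M}$; and if $g,\tilde g\in\mathcal{M}$, then $\tilde g-g$ is of type $III$.
   Context: **The group $GN$.** On $\mathbb{R}^n$ rename the standard basis $\{k,l,m_1,\dots,m_{n-2}\}$ and let $\eta$ be the Minkowski inner product with $\eta(k,l)=1$, $\eta(m_i,m_j)=\delta_{ij}$ and all other products of basis vectors zero. $GN\subset GL(n,\mathbb{R})$ is the Lie group of invertible linear maps $f$ with (1) $f(k)\in\mathbb{R}k$; (2) $\eta(f(w),f(\tilde w))=\eta(w,\tilde w)$ for all $w,\tilde w\in\{k\}^\perp$; (3) $\eta(f(k),f(z))=\eta(k,z)$ for all $z\in\mathbb{R}^n$. Let $Sim(n-2)=\{f\in\mathcal{O}(1,n-1): f(k)\in\mathbb{R}k\}=GN\cap\mathcal{O}(1,n-1)$, where $\mathcal{O}(1,n-1)$ is the orthogonal group of $\eta$. **$GN$-structures.** A $GN$-structure $P\to M$ is a principal $GN$-subbundle of the frame bundle of $M$ (fibres over $x$ are subsets of $GL(\mathbb{R}^n,T_xM)$). It determines distributions $\lambda_x=u(\mathbb{R}k)$ and $\Lambda_x=u(\{k\}^\perp)$ ($u\in P_x$ arbitrary), of dimension $1$ and codimension $1$, with $\lambda\subset\Lambda$.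 **Metrics belonging to $P$.** A Lorentzian metric $g$ on $M$ belongs to $P$ if there is a principal $Sim(n-2)$-subbundle $Q\subset P$ such that the elements of $Q$ are null-frames for $g$, i.e. $g(u(v),u(w))=\eta(v,w)$ for all $u\in Q$, $v,w\in\mathbb{R}^n$. $\mathcal{M}$ denotes the set of all such metrics. **Type $III$.** Let $\lambda^*\subset T^*M$ be the annihilator of $\Lambda$ and $\Lambda^*\subset T^*M$ the annihilator of $\lambda$. A symmetric covariant $2$-tensor is of type $III$ if it is a section of $\lambda^*\otimes\Lambda^*+\Lambda^*\otimes\lambda^*$; equivalently, it vanishes on $\lambda\times TM$ and on $\Lambda\times\Lambda$. *)

(* Defs.v *)
From HB Require Import structures.
From mathcomp Require Import all_boot all_order all_algebra.
From mathcomp Require Import all_classical all_reals all_analysis.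

Set Implicit Arguments.
Unset Strict Implicit.
Unset Printing Implicit Defensive.
Import Order.TTheory GRing.Theory Num.Theory.
Import numFieldNormedType.Exports.
Local Open Scope ring_scope.
Local Open Scope classical_set_scope.

(* [Ck k U f]: the map [f] is of class C^k on the open set [U].  All the spaces
   below are finite dimensional, so that the continuity of the derivative
   [U -> Hom(V, W)] may be tested vector by vector. *)
Fixpoint Ck (R : realType) (V W : normedModType R) (k : nat)
    (U : set V) (f : V -> W) : Prop :=
  match k with
  | 0%N => forall x, U x -> {for x, continuous f}
  | k'.+1 => (forall x, U x -> differentiable f x) /\
             (forall v, Ck k' U (fun x => 'd f x v))
  end.

Definition smooth (R : realType) (V W : normedModType R)
    (U : set V) (f : V -> W) : Prop :=
  forall k, Ck k U f.

(* [cmap] and [cinv] are only relevant on [cdom] and on its image. *)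
Record chart (R : realType) (n : nat) (M : topologicalType) := Chart {
  cdom : set M;
  cmap :> M -> 'cV[R]_n;
  cinv : 'cV[R]_n -> M;
  cdom_open : open cdom;
  cimg_open : open (cmap @` cdom);
  cmapK : forall x, cdom x -> cinv (cmap x) = x;
  cmap_continuous : {within cdom, continuous cmap};
  cinv_continuous : {within cmap @` cdom, continuous cinv} }.

(* The smooth structure is the one generated by [atlas], which need not be
   maximal: smoothness is always tested in all the charts of [atlas].  The
   function [chart_at] selects a chart around each point, in order to represent
   the tangent spaces; see [tangent]. *)
Record manifold (R : realType) (n : nat) := Manifold {
  points :> topologicalType;
  manifold_hausdorff : hausdorff_space points;
  manifold_second_countable : @second_countable points;
  atlas : set (chart R n points);
  chart_at : points -> chart R n points;
  chart_at_atlas : forall x, atlas (chart_at x);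
  chart_at_dom : forall x, cdom (chart_at x) x;
  atlas_smooth : forall c c', atlas c -> atlas c' ->
    smooth (c @` (cdom c `&` cdom c')) (c' \o cinv c) }.

(* The tangent space at [x] is R^n, a vector being given by its coordinates in
   the chart [chart_at M x]; the coordinates in the other charts around [x] are
   obtained from these through the differential of the change of charts. *)
Definition tangent (R : realType) (n : nat) (M : manifold R n) (x : M) : Type :=
  'cV[R]_n.

(* The coordinates in the chart [c] of a tangent vector at [x]. *)
Definition tcoord (R : realType) (n : nat) (M : manifold R n)
    (c : chart R n M) (x : M) (v : tangent x) : 'cV[R]_n :=
  'd (c \o cinv (chart_at x)) (chart_at x x) v.

(* The tangent vector at [x] whose coordinates in the chart [c] are [v]. *)
Definition tvect (R : realType) (n : nat) (M : manifold R n)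
    (c : chart R n M) (x : M) (v : 'cV[R]_n) : tangent x :=
  'd (chart_at x \o cinv c) (c x) v.

Definition smooth_vector_field (R : realType) (n : nat) (M : manifold R n)
    (U : set M) (X : forall x : M, tangent x) : Prop :=
  forall c, atlas c ->
    smooth (c @` (cdom c `&` U)) (fun z => tcoord c (X (cinv c z))).

(* A frame at [x] is a linear isomorphism from R^n onto the tangent space at
   [x], that is, an invertible matrix [u], mapping [v] to [u *m v]. *)
Definition frames (R : realType) (n : nat) (M : manifold R n) (x : M) :
    set 'M[R]_n :=
  [set u | u \in unitmx].

Definition fapp (R : realType) (n : nat) (M : manifold R n) (x : M)
    (u : 'M[R]_n) (v : 'cV[R]_n) : tangent x :=
  u *m v.

Definition smooth_frame_field (R : realType) (n : nat) (M : manifold R n)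
    (U : set M) (s : M -> 'M[R]_n) : Prop :=
  forall v : 'cV[R]_n, smooth_vector_field U (fun x => fapp x (s x) v).

(* To be used for a closed subgroup [G] of GL(n, R), which acts on the right on
   frames, freely since frames are invertible.  Local triviality is given by
   [psb_section]: a smooth local section [s] provides the equivariant local
   trivialization [(x, f) |-> s x *m f]. *)
Record principal_subbundle (R : realType) (n : nat) (M : manifold R n)
    (G : set 'M[R]_n) (P : M -> set 'M[R]_n) : Prop := {
  psb_frame : forall x, P x `<=` frames x;
  psb_action : forall x u f, P x u -> G f -> P x (u *m f);
  psb_transitive : forall x u u', P x u -> P x u' ->
    exists2 f, G f & u' = u *m f;
  psb_section : forall x, exists (U : set M) (s : M -> 'M[R]_n),
    [/\ open U, U x, smooth_frame_field U s & forall y, U y -> P y (s y)] }.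

(* The basis k, l, m_1, ..., m_n of R^(n+2) is e_0, e_1, e_2, ..., e_(n+1). *)
Definition kvec (R : realType) (n : nat) : 'cV[R]_n.+2 := delta_mx 0 0.

Definition eta (R : realType) (n : nat) (v w : 'cV[R]_n.+2) : R :=
  v 0 0 * w 1 0 + v 1 0 * w 0 0 + \sum_(i < n.+2 | (1 < i)%N) v i 0 * w i 0.

Definition kline (R : realType) (n : nat) : set 'cV[R]_n.+2 :=
  [set v | exists a : R, v = a *: kvec R n].

Definition kperp (R : realType) (n : nat) : set 'cV[R]_n.+2 :=
  [set v | eta (kvec R n) v = 0].

Definition GN (R : realType) (n : nat) : set 'M[R]_n.+2 :=
  [set f | [/\ f \in unitmx,
    kline (f *m kvec R n),
    forall w w', kperp w -> kperp w' -> eta (f *m w) (f *m w') = eta w w' &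
    forall z, eta (f *m kvec R n) (f *m z) = eta (kvec R n) z]].

Definition orthogonal_eta (R : realType) (n : nat) : set 'M[R]_n.+2 :=
  [set f | f \in unitmx /\ forall v w, eta (f *m v) (f *m w) = eta v w].

Definition Sim (R : realType) (n : nat) : set 'M[R]_n.+2 :=
  [set f | orthogonal_eta f /\ kline (f *m kvec R n)].

Definition tensor2 (R : realType) (n : nat) (M : manifold R n) : Type :=
  forall x : M, tangent x -> tangent x -> R.

Definition addt (R : realType) (n : nat) (M : manifold R n)
    (g h : tensor2 M) : tensor2 M :=
  fun x v w => g x v w + h x v w.

Definition subt (R : realType) (n : nat) (M : manifold R n)
    (g h : tensor2 M) : tensor2 M :=
  fun x v w => g x v w - h x v w.

Record symmetric_tensor_field (R : realType) (n : nat) (M : manifold R n)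
    (g : tensor2 M) : Prop := {
  stf_linearl : forall (x : M) (w : 'cV[R]_n),
    scalar (fun v : 'cV[R]_n => g x v w);
  stf_linearr : forall (x : M) (v : 'cV[R]_n),
    scalar (fun w : 'cV[R]_n => g x v w);
  stf_sym : forall (x : M) (v w : tangent x), g x v w = g x w v;
  stf_smooth : forall c, atlas c -> forall v w : 'cV[R]_n,
    smooth (c @` cdom c)
      (fun z : 'cV[R]_n =>
         g (cinv c z) (tvect c (cinv c z) v) (tvect c (cinv c z) w) : R^o) }.

(* Signature with exactly one minus sign, as for [eta]: on the basis formed by
   the columns of [b], the metric is diag(-1, 1, ..., 1). *)
Definition lorentzian_metric (R : realType) (n : nat) (M : manifold R n.+1)
    (g : tensor2 M) : Prop :=
  symmetric_tensor_field g /\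
  forall x : M, exists2 b : 'M[R]_n.+1, b \in unitmx &
    forall i j, g x (col i b) (col j b) =
      if i == j then (if i == ord0 then - 1 else 1) else 0.

Definition GN_structure (R : realType) (n : nat) (M : manifold R n.+2)
    (P : M -> set 'M[R]_n.+2) : Prop :=
  principal_subbundle (@GN R n) P.

(* These do not depend on the choice of [u] in [P x], which is nonempty. *)
Definition lambda (R : realType) (n : nat) (M : manifold R n.+2)
    (P : M -> set 'M[R]_n.+2) (x : M) : set (tangent x) :=
  [set v | exists2 u, P x u & (fapp x u @` @kline R n) v].

Definition Lambda (R : realType) (n : nat) (M : manifold R n.+2)
    (P : M -> set 'M[R]_n.+2) (x : M) : set (tangent x) :=
  [set v | exists2 u, P x u & (fapp x u @` @kperp R n) v].

Definition null_frame (R : realType) (n : nat) (M : manifold R n.+2)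
    (g : tensor2 M) (x : M) (u : 'M[R]_n.+2) : Prop :=
  forall v w : 'cV[R]_n.+2, g x (fapp x u v) (fapp x u w) = eta v w.

Definition metrics (R : realType) (n : nat) (M : manifold R n.+2)
    (P : M -> set 'M[R]_n.+2) : set (tensor2 M) :=
  [set g | lorentzian_metric g /\
    exists Q : M -> set 'M[R]_n.+2,
      [/\ principal_subbundle (@Sim R n) Q,
          forall x, Q x `<=` P x &
          forall x u, Q x u -> null_frame g x u]].

Definition annihilator (R : realType) (n : nat) (M : manifold R n) (x : M)
    (D : set (tangent x)) : set {scalar 'cV[R]_n} :=
  [set a | forall v, D v -> a v = 0].

(* Membership of [T] in the sum of A (x) B and B (x) A, for sets A and B of
   covectors at [x]. *)
Definition sym_tensor_sum (R : realType) (n : nat) (M : manifold R n) (x : M)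
    (A B : set {scalar 'cV[R]_n}) (T : tangent x -> tangent x -> R) : Prop :=
  exists (p q : nat) (a a' : nat -> {scalar 'cV[R]_n})
         (b b' : nat -> {scalar 'cV[R]_n}),
    [/\ forall i, A (a i), forall i, B (b i),
        forall j, A (a' j), forall j, B (b' j) &
        forall v w, T v w = \sum_(i < p) a i v * b i w +
                            \sum_(j < q) b' j v * a' j w].

Definition type_III (R : realType) (n : nat) (M : manifold R n.+2)
    (P : M -> set 'M[R]_n.+2) (T : tensor2 M) : Prop :=
  symmetric_tensor_field T /\
  forall x, sym_tensor_sum (annihilator (@Lambda R n M P x))
                           (annihilator (@lambda R n M P x)) (T x).

(* Main.v *)
(* Call a smooth symmetric tensor g in agreement with P, with weight phi, if for
   every u in P the form g(u v, u w) equals phi eta(v, w) whenever v = k or both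
   v and w lie in k^perp.  The group GN preserves these values of eta, so that
   a single u per point suffices.  Agreement with weight 0 is type III,
   and agreement with weight 1 is being a metric of P: given u in P, replacing l
   by l + alpha k - sum_i g(u l, u m_i) m_i for a suitable alpha is an element of
   GN which turns u into a null frame.  Weights add up when tensors do, hence the
   two affine statements.  For the existence, a local section s of P yields the
   tensor eta(s^-1 v, s^-1 w), which is cut off by bump functions and glued. *)
Require Import Defs.
From HB Require Import structures.
From mathcomp Require Import all_boot all_order all_algebra.
From mathcomp Require Import all_classical all_reals all_analysis.
From mathcomp Require Import ring.
(* Again last: [HB.structures] has its own [eta]. *)
Import Defs.
Set Implicit Arguments.
Unset Strict Implicit.
Unset Printing Implicit Defensive.
Import Order.TTheory GRing.Theory Num.Theory.
Import numFieldNormedType.Exports.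
Local Open Scope ring_scope.
Local Open Scope classical_set_scope.

(** * Calculus of C^k maps *)

(** Gluing with cut-offs fails for Lorentzian metrics in general, because a convex combination of
    two may degenerate. It succeeds here because the prescribed values contain all that decides
    nondegeneracy: in a frame of [P] only g(l, l) and the g(l, m_i) are left free, and the change of
    frame absorbs them. It moves l alone, by a vector of k^perp, which keeps it in [GN]; and its
    components are polynomials in the free values, without square roots, so that smooth sections of
    [P] become smooth sections of null frames. Requiring the new l to be null gives alpha = (sum_i
    g(u l, u m_i)^2 - g(u l, u l)) / 2. The bundle [Q] can then be taken to consist of all null
    frames in [P]. A tensor of weight 0 is split by means of the covector that vanishes on Lambda
    and is 1 on u l. *)

Lemma linear_colE (R : comNzRingType) (W : lmodType R) m
    (f : {linear 'cV[R]_m -> W}) (v : 'cV[R]_m) :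
  \sum_(i < m) v i 0 *: f (delta_mx i 0) = f v.
Proof.
rewrite [in RHS](matrix_sum_delta v) linear_sum; apply: eq_bigr => i _.
by rewrite big_ord1 linearZ.
Qed.

Section Ck.
Context {R : realType} {V : normedModType R}.
Implicit Types (U : set V).

(** The first order expansion of [f] at [x] also serves [g], as the two maps coincide near [x];
    [diff_unique] then identifies the differentials. *)
Lemma near_eq_diff (W : normedModType R) (f g : V -> W) (x : V) :
  (\forall y \near x, f y = g y) -> differentiable f x ->
  differentiable g x /\ 'd g x = 'd f x :> (V -> W).
Proof.
move=> fg /diff_locallyP [dc df].
have fgx : f x = g x by exact: nbhs_singleton fg.
have dg : g \o shift x = cst (g x) + 'd f x +o_ 0 id.
  apply/eqaddoP => e e0; move/eqaddoP : df => /(_ e e0) df.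
  have fg0 : \forall y \near (0 : V), f (y + x) = g (y + x).
    by move: fg; rewrite (near_shift 0 x) subr0; apply: filterS => y /=.
  near=> y.
  rewrite -[leLHS]/(`|g (y + x) - (g x + 'd f x y)|) -fgx.
  rewrite -(near fg0 y) //.
  exact: (near df y).
have e := diff_unique dc dg; split; last exact: e.
by apply/diff_locallyP; rewrite e.
Unshelve. all: by end_near. Qed.

(** Openness of [U] turns equality on [U] into equality near each of its points, which differentials
    require. Derivative formulas valid on [U] only enter the inductions below through this lemma. *)
Lemma Ck_eq (W : normedModType R) k U (f g : V -> W) : open U ->
  (forall x, U x -> f x = g x) -> Ck k U f -> Ck k U g.
Proof.
move=> oU; elim: k f g => [|k IH] f g fg /=.
  move=> cf x Ux; have fgx : \forall y \near x, f y = g y.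
    by apply: filterS (open_nbhs_nbhs (conj oU Ux)) => y; exact: fg.
  rewrite /prop_for /continuous_at -(fg x Ux).
  exact: cvg_trans (near_eq_cvg fgx) (cf x Ux).
case=> df cf; have H x : U x -> differentiable g x /\ 'd g x = 'd f x :> (V -> W).
  move=> Ux; apply: near_eq_diff (df x Ux).
  by apply: filterS (open_nbhs_nbhs (conj oU Ux)) => y; exact: fg.
split; first by move=> x /H [].
by move=> v; apply: IH (cf v) => x /H [_ ->].
Qed.

(** Each clause of [Ck] is checked at single points, with limits and derivatives taken in all of [V]
    and not relative to the set; this is why [O] may be any set containing the point. *)
Lemma Ck_local (W : normedModType R) k U (f : V -> W) :
  (forall x, U x -> exists2 O : set V, O x & Ck k O f) -> Ck k U f.
Proof.
elim: k f => [|k IH] f H /=; first by move=> x /H [B Ox cO]; exact: cO.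
split; first by move=> x /H [B Ox [dO _]]; exact: dO.
by move=> v; apply: IH => x /H [B Ox [_ /(_ v)]]; exists B.
Qed.

Lemma Ck_sub (W : normedModType R) k U U' (f : V -> W) :
  U' `<=` U -> Ck k U f -> Ck k U' f.
Proof. by move=> UU' cf; apply: Ck_local => x /UU' Ux; exists U. Qed.

Lemma CkS (W : normedModType R) k U (f : V -> W) : Ck k.+1 U f -> Ck k U f.
Proof.
elim: k f => [|k IH] f.
  by move=> [df _] x Ux; exact/differentiable_continuous/df.
by move=> [df cf]; split => // v; apply: IH.
Qed.

Lemma Ck_cst (W : normedModType R) k U (a : W) : open U -> Ck k U (fun=> a).
Proof.
move=> oU; elim: k a => [|k IH] a; first by move=> x _; exact: cvg_cst.
split; first by move=> x _; exact: differentiable_cst.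
move=> v; apply: (Ck_eq oU _ (IH 0)) => x _.
exact: (esym (congr1 (fun h => h v) (diff_cst a x))).
Qed.

Lemma Ck_cstR k U (a : R) : open U -> Ck k U (fun=> a).
Proof. exact: (Ck_cst k (a : R^o)). Qed.

Lemma CkD (W : normedModType R) k U (f g : V -> W) : open U ->
  Ck k U f -> Ck k U g -> Ck k U (fun x => f x + g x).
Proof.
move=> oU; elim: k f g => [|k IH] f g /=.
  by move=> cf cg x Ux; apply: cvgD; [exact: cf|exact: cg].
move=> [df cf] [dg cg]; split.
  by move=> x Ux; apply: (@differentiableD _ _ _ f g); [exact: df|exact: dg].
move=> v; apply: (@Ck_eq _ k U (fun x => 'd f x v + 'd g x v) _ oU).
  move=> x Ux.
  exact: (esym (congr1 (fun h => h v) (diffD (df x Ux) (dg x Ux)))).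
exact: IH (cf v) (cg v).
Qed.

Lemma CkZl (W : normedModType R) k U (f : V -> R) (a : W) : open U ->
  Ck k U f -> Ck k U (fun x => f x *: a).
Proof.
move=> oU; elim: k f => [|k IH] f /=.
  by move=> cf x Ux; apply: cvgZr_tmp; exact: cf.
move=> [df cf]; split.
  by move=> x Ux; exact/differentiableZl/df.
move=> v; apply: (@Ck_eq _ k U (fun x => 'd f x v *: a) _ oU).
  by move=> x Ux; exact: (esym (congr1 (fun h => h v) (diffZl a (df x Ux)))).
exact: IH (cf v).
Qed.

Lemma CkM k U (f g : V -> R) : open U ->
  Ck k U f -> Ck k U g -> Ck k U (fun x => f x * g x).
Proof.
move=> oU; elim: k f g => [|k IH] f g.
  by move=> cf cg x Ux; apply: cvgM; [exact: cf|exact: cg].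
move=> Cf Cg; have [df cf] := Cf; have [dg cg] := Cg; split.
  by move=> x Ux; apply: (@differentiableM _ _ f g); [exact: df|exact: dg].
move=> v; apply: (@Ck_eq _ k U (fun x => f x * 'd g x v + g x * 'd f x v) _ oU).
  move=> x Ux.
  exact: (esym (congr1 (fun h => h v) (diffM (df x Ux) (dg x Ux)))).
exact: (CkD oU (IH _ _ (CkS Cf) (cg v)) (IH _ _ (CkS Cg) (cf v))).
Qed.

Lemma CkN k U (f : V -> R) : open U -> Ck k U f -> Ck k U (fun x => - f x).
Proof.
move=> oU cf; apply: (@Ck_eq _ k U (fun x => -1 * f x)) => //.
  by move=> x _; rewrite mulN1r.
by apply: CkM => //; exact: Ck_cst.
Qed.

Lemma CkB k U (f g : V -> R) : open U ->
  Ck k U f -> Ck k U g -> Ck k U (fun x => f x - g x).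
Proof. by move=> oU cf cg; apply: CkD => //; exact: CkN. Qed.

(** The induction keeps [f] fixed: the derivative of 1/f is made of 1/f itself, one order lower, and
    of the derivative of [f]. *)
Lemma CkV k U (f : V -> R) : open U -> (forall x, U x -> f x != 0) ->
  Ck k U f -> Ck k U (fun x => (f x)^-1).
Proof.
move=> oU f0; elim: k => [|k IH].
  by move=> cf x Ux; apply: cvgV; [exact: f0|exact: cf].
move=> Cf; have [df cf] := Cf; split.
  by move=> x Ux; apply: differentiableV; [exact: df|exact: f0].
move=> v; apply: (@Ck_eq _ k U
    (fun x => - ((f x)^-1 * (f x)^-1 * 'd f x v)) _ oU).
  move=> x Ux; rewrite -invfM -expr2 -mulNr.
  exact: (esym (congr1 (fun h => h v) (diffV (df x Ux) (f0 x Ux)))).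
apply: (CkN oU); apply: (CkM oU _ (cf v)).
by apply: (CkM oU); exact: IH (CkS Cf).
Qed.

Lemma Ck_sum (W : normedModType R) k U I (r : seq I) (Q : pred I)
    (f : I -> V -> W) : open U -> (forall i, Q i -> Ck k U (f i)) ->
  Ck k U (fun x => \sum_(i <- r | Q i) f i x).
Proof.
move=> oU cf; elim: r => [|i r IH].
  by apply: (Ck_eq oU _ (Ck_cst k 0 oU)) => x _; rewrite big_nil.
have [Qi|Qi] := boolP (Q i).
  apply: (Ck_eq oU _ (CkD oU (cf i Qi) IH)) => x _.
  by rewrite big_cons Qi.
by apply: (Ck_eq oU _ IH) => x _; rewrite big_cons (negbTE Qi).
Qed.

Lemma Ck_prod k U I (r : seq I) (Q : pred I)
    (f : I -> V -> R) : open U -> (forall i, Q i -> Ck k U (f i)) ->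
  Ck k U (fun x => \prod_(i <- r | Q i) f i x).
Proof.
move=> oU cf; elim: r => [|i r IH].
  by apply: (Ck_eq oU _ (Ck_cstR k _ oU)) => x _; rewrite big_nil.
have [Qi|Qi] := boolP (Q i).
  apply: (Ck_eq oU _ (CkM oU (cf i Qi) IH)) => x _.
  by rewrite big_cons Qi.
by apply: (Ck_eq oU _ IH) => x _; rewrite big_cons (negbTE Qi).
Qed.

Lemma diff_mxcoord m n (f : V -> 'M[R]_(m, n)) x i j : differentiable f x ->
  differentiable (fun y => f y i j) x /\
  forall v, 'd (fun y => f y i j) x v = 'd f x v i j.
Proof.
pose c (N : 'M[R]_(m, n)) : R := N i j.
have clin : linear c by move=> a u v; rewrite /c !mxE.
pose cM := GRing.isLinear.Build _ _ _ _ _ clin.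
pose cL : {linear 'M[R]_(m, n) -> R} := HB.pack c cM.
have cC : continuous cL by exact: coord_continuous.
have dc y : differentiable cL y by exact: linear_differentiable.
move=> df; split; first exact: (differentiable_comp df (dc _)).
move=> v; rewrite -/(c ('d f x v)) -[c _]/(cL _).
rewrite -[in RHS](diff_lin (f x) cC).
exact: (congr1 (fun h => h v) (diff_comp df (dc (f x)))).
Qed.

Lemma Ck_coord m n k U (f : V -> 'M[R]_(m, n)) i j : open U ->
  Ck k U f -> Ck k U (fun x => f x i j).
Proof.
move=> oU; elim: k f => [|k IH] f.
  move=> cf x Ux; apply: (@continuous_comp _ _ _ f (fun N => N i j)).
    exact: cf.
  exact: coord_continuous.
move=> [df cf]; split; first by move=> x /df /(diff_mxcoord i j) [].
move=> v; apply: (@Ck_eq _ k U (fun x => 'd f x v i j) _ oU).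
  by move=> x /df /(diff_mxcoord i j) [_ e]; exact: (esym (e v)).
exact: (IH _ (cf v)).
Qed.

Lemma Ck_cV n k U (f : V -> 'cV[R]_n) : open U ->
  (forall i, Ck k U (fun x => f x i 0)) -> Ck k U f.
Proof.
move=> oU cf; pose g x := \sum_(i < n) f x i 0 *: (delta_mx i 0 : 'cV[R]_n).
apply: (@Ck_eq _ k U g _ oU) => [x _|]; last first.
  by apply: (Ck_sum _ oU) => i _; exact: (CkZl (delta_mx i 0) oU (cf i)).
apply/colP => i; rewrite summxE (bigD1 i) //= big1 ?addr0 => [|j ji].
  by rewrite !mxE !eqxx mulr1.
by rewrite !mxE eq_sym (negbTE ji) mulr0.
Qed.

(** [Ck] tests differentials on fixed vectors, but the chain rule applies ['d g (f x)] to
    ['d f x v], which moves with [x]. Expanding this vector in the standard basis leaves products of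
    scalar functions, and the induction applies to each ['d g y (delta_mx i 0)]. *)
Lemma Ck_comp m k U (O : set 'cV[R]_m) (f : V -> 'cV[R]_m) (g : 'cV[R]_m -> R) :
  open U -> open O -> (forall x, U x -> O (f x)) ->
  Ck k O g -> Ck k U f -> Ck k U (g \o f).
Proof.
move=> oU oO UO; elim: k g => [|k IH] g.
  by move=> cg cf x Ux; apply: continuous_comp; [exact: cf|exact/cg/UO].
move=> [dg cg] Cf; have [df cf] := Cf; split.
  by move=> x Ux; apply: differentiable_comp; [exact: df|exact/dg/UO].
move=> v; apply: (@Ck_eq _ k U (fun x => \sum_(i < m)
   'd f x v i 0 * ('d g (f x) (delta_mx i 0))) _ oU).
  move=> x Ux.
  apply: etrans _ (esym (congr1 (fun h => h v)
    (diff_comp (df x Ux) (dg _ (UO x Ux))))).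
  exact: linear_colE.
apply: (Ck_sum _ oU) => i _; apply: (CkM oU); first exact: Ck_coord (cf v).
exact: (IH (fun y => 'd g y (delta_mx i 0)) (cg _) (CkS Cf)).
Qed.

Lemma Ck_compR k U (f : V -> R) (g : R -> R) : open U ->
  Ck k setT g -> Ck k U f -> Ck k U (g \o f).
Proof.
move=> oU; elim: k g => [|k IH] g.
  by move=> cg cf x Ux; apply: continuous_comp; [exact: cf|exact/cg].
move=> [dg cg] Cf; have [df cf] := Cf; split.
  by move=> x Ux; apply: differentiable_comp; [exact: df|exact/dg].
move=> v; apply: (@Ck_eq _ k U (fun x => 'd f x v * 'd g (f x) 1) _ oU).
  move=> x Ux.
  apply: etrans _ (esym (congr1 (fun h => h v)
    (diff_comp (df x Ux) (dg (f x) I)))).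
  have e (h : {linear R^o -> R^o}) (a : R^o) : a *: h 1 = h a.
    by rewrite -linearZ; congr (h _); exact: mulr1.
  exact: e.
apply: (CkM oU (cf v)).
exact: (IH (fun y => 'd g y 1) (cg _) (CkS Cf)).
Qed.

End Ck.

(** * Bump functions *)

Section flat.
Context {R : realType}.

(* Unlike [expR (- t^-1)] alone, this family is stable under differentiation, up
   to linear combinations; see [is_diff_flat]. *)
Definition flat (m : nat) (t : R) : R :=
  if 0 < t then t^-1 ^+ m * expR (- t^-1) else 0.

Lemma flat_le0 m t : t <= 0 -> flat m t = 0.
Proof. by rewrite /flat; case: ltP. Qed.

Lemma flat_ge0 m t : 0 <= flat m t.
Proof.
rewrite /flat; case: ltP => // t0.
by rewrite mulr_ge0 ?expR_ge0 // exprn_ge0 // invr_ge0 ltW.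
Qed.

Lemma flat_gt0 m t : 0 < t -> 0 < flat m t.
Proof.
by move=> t0; rewrite /flat t0 mulr_gt0 ?expR_gt0 // exprn_gt0 // invr_gt0.
Qed.

(** The single term s^(m+1) / (m+1)! of the exponential series at s = 1/t already bounds e^s from
    below. *)
Lemma flat_le_fact m t : flat m.+1 t <= m.+1`!%:R.
Proof.
have [t0|t0] := leP t 0; first by rewrite flat_le0 // ler0n.
rewrite /flat t0 expRN ler_pdivrMr ?expR_gt0 //.
have s0 : 0 <= t^-1 by rewrite invr_ge0 ltW.
rewrite mulrC -ler_pdivrMr ?ltr0n ?fact_gt0 //.
by apply: le_trans (expR_ge1Dxn m s0); rewrite lerDr ler01.
Qed.

(** Two more powers of 1/t are traded for a factor t^2; such a quadratic bound makes the derivative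
    at 0 exist and vanish. *)
Lemma flat_le_sqr m t : flat m t <= m.+2`!%:R * t ^+ 2.
Proof.
have [t0|t0] := leP t 0.
  by rewrite flat_le0 // mulr_ge0 ?ler0n // sqr_ge0.
have -> : flat m t = flat m.+2 t * t ^+ 2.
  have tn0 : t != 0 by rewrite gt_eqF.
  by rewrite /flat t0 -[m.+2]addn2 exprD; field.
by rewrite ler_wpM2r ?sqr_ge0 // flat_le_fact.
Qed.

Lemma is_diff_flat0 m : differentiable (flat m) (0 : R) /\
  'd (flat m) (0 : R) = cst 0 :> (R -> R).
Proof.
have [c0 _] := @dcst _ R R 0 0.
have e : flat m \o shift 0 =
    cst (flat m 0) + (\0 : {linear R -> R^o}) +o_ (0 : R) id.
  apply/eqaddoP => e e0; near=> y.
  rewrite -[leLHS]/(`|flat m (y + 0) - (flat m 0 + 0)|).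
  rewrite !addr0 (flat_le0 m (lexx 0)) subr0 ger0_norm ?flat_ge0 //.
  apply: le_trans (flat_le_sqr m y) _.
  rewrite -(real_normK (num_real y)) expr2 mulrA; apply: ler_wpM2r => //.
  rewrite mulrC -ler_pdivlMr ?ltr0n ?fact_gt0 // ltW //.
  near: y; apply/nbhs_normP; exists (e / m.+2`!%:R) => /=.
    by rewrite divr_gt0 // ltr0n fact_gt0.
  by move=> y /=; rewrite sub0r normrN.
have du := diff_unique c0 e; split; last exact: du.
by apply/diff_locallyP; rewrite du.
Unshelve. all: by end_near. Qed.

Lemma is_diff_flat m (t : R) : differentiable (flat m) t /\
  forall v, 'd (flat m) t v = v * (flat m.+2 t - m%:R * flat m.+1 t).
Proof.
have [t0|t0|->] := ltgtP t 0.
- have nt : \forall y \near t, cst 0 y = flat m y.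
    near=> y; rewrite flat_le0 //; apply: ltW; near: y.
    exact: lt_nbhsl.
  have [dt et] := near_eq_diff nt (differentiable_cst (0 : R) t).
  split=> // v; rewrite !(flat_le0 _ (ltW t0)) mulr0 subr0 mulr0.
  rewrite (congr1 (fun h => h v) et).
  exact: (congr1 (fun h => h v) (diff_cst (0 : R^o) t)).
- pose g (y : R) := y^-1 ^+ m * expR (- y^-1).
  have nt : \forall y \near t, g y = flat m y.
    near=> y; rewrite /flat ifT //; near: y.
    exact: lt_nbhsr.
  have tn0 : t != 0 by rewrite gt_eqF.
  have dg : is_derive t 1 g (flat m.+2 t - m%:R * flat m.+1 t).
    have dV : is_derive t 1 (@GRing.inv R) (- t ^- 2).
      apply: DeriveDef; first exact: (@derivableV _ _ id).
      rewrite (@deriveV _ _ id t 1 tn0) // derive_id.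
      exact: mulr1.
    have dX := is_deriveX m dV.
    have dE := @is_derive1_comp _ expR (- @GRing.inv R) t _ _
      (is_derive_expR (- t^-1)) (is_deriveN dV).
    have dM := is_deriveM dX dE.
    have ge : g = (@GRing.inv R ^+ m) * (expR \o (- @GRing.inv R)).
      by apply/funext => y; rewrite -[RHS]/((@GRing.inv R ^+ m) y * _) exprfctE.
    rewrite ge; apply: (is_derive_eq dM).
    rewrite exprfctE.
    rewrite /flat t0 /GRing.scale /= -!exprVn.
    case: m {nt g dX dM ge} => [|m]; first by rewrite /= !mul0r mulr0 subr0; ring.
    by rewrite /= !exprS; ring.
  have dgt : differentiable g t by apply/derivable1_diffP.
  have [dt et] := near_eq_diff nt dgt.
  split=> // v; rewrite (congr1 (fun h => h v) et).
  rewrite (congr1 (fun h => h v) (diff1E dgt)) derive1E.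
  by rewrite (@derive_val _ _ _ _ _ _ _ dg).
- have [d0 e0] := is_diff_flat0 m; split => // v.
  by rewrite (congr1 (fun h => h v) e0) !flat_le0 // mulr0 subr0 mulr0.
Unshelve. all: by end_near. Qed.

Lemma Ck_flat k m : Ck k [set: R] (flat m).
Proof.
elim: k m => [|k IH] m.
  move=> t _; apply: differentiable_continuous.
  by have [] := is_diff_flat m t.
split; first by move=> t _; have [] := is_diff_flat m t.
have oT : open [set: R] by exact: openT.
move=> v; apply: (@Ck_eq _ _ _ k setT
    (fun t => v * (flat m.+2 t - m%:R * flat m.+1 t)) _ oT).
  by move=> t _; have [_ ->] := is_diff_flat m t.
apply: (CkM oT (Ck_cstR k _ oT)).
apply: (CkB oT (IH _)); apply: (CkM oT _ (IH _)).
exact: (Ck_cstR k _ oT).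
Qed.

(** Transposition identifies the box with a product of segments in the space of row vectors, where
    [rV_compact] applies. *)
Lemma compact_box n (p : 'cV[R]_n) (e : R) :
  compact [set z : 'cV[R]_n | forall i, `|z i 0 - p i 0| <= e].
Proof.
pose A i := [set t : R | `|t - p i 0| <= e].
have cA i : compact (A i).
  have -> : A i = `[p i 0 - e, p i 0 + e]%classic.
    by apply/seteqP; split => t; rewrite /A /= in_itv /= ler_distl.
  exact: segment_compact.
have ctr : continuous (@trmx R 1 n).
  move=> M s /= /(nbhs_ballP (M^T)) [d d0 ds].
  apply/nbhs_ballP; exists d => //= N [_ MN]; apply: ds; split => // i j.
  by rewrite !mxE; exact: MN.
have -> : [set z : 'cV[R]_n | forall i, `|z i 0 - p i 0| <= e] =
    @trmx R 1 n @` [set v : 'rV[R]_n | forall i, A i (v ord0 i)].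
  apply/seteqP; split => [z /= zA|_ /= [z zA <-] i].
    exists z^T; last by rewrite trmxK.
    by move=> i; rewrite /A /= mxE; exact: zA.
  by rewrite mxE; exact: zA.
apply: continuous_compact; last exact: rV_compact.
by apply: continuous_subspaceT.
Qed.

Lemma bump_exists n (p : 'cV[R]_n) (O : set 'cV[R]_n) : nbhs p O ->
  exists (h : 'cV[R]_n -> R) (V K : set 'cV[R]_n),
    [/\ smooth setT h, open V /\ V p, forall z, V z -> h z = 1,
        compact K /\ K `<=` O & forall z, ~ K z -> h z = 0].
Proof.
move=> /nbhs_ballP [e /= e0 eO].
(* The norm of ['cV[R]_n] is the maximum norm, which is not smooth, hence the sum of squares. With r
   = (e/2)^2, S z < r puts every coordinate within e/2 of that of [p], so [h] vanishes off a compact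
   box inside the ball of radius [e]. *)
pose S (z : 'cV[R]_n) := \sum_i (z i 0 - p i 0) ^+ 2.
pose r := (e / 2) ^+ 2.
have r0 : 0 < r by rewrite exprn_gt0 // divr_gt0.
(* The two terms never vanish together, since r/2 < r. Where S < r/2 the second one is 0 and the
   quotient below equals 1. *)
pose D z := flat 0 (r - S z) + flat 0 (S z - r / 2).
have D0 z : 0 < D z.
  rewrite /D; have [h|h] := ltP (S z) r.
    by rewrite ltr_pwDl ?flat_ge0 // flat_gt0 // subr_gt0.
  rewrite ltr_wpDl ?flat_ge0 // flat_gt0 // subr_gt0.
  by apply: lt_le_trans h; rewrite ltr_pdivrMr // ltr_pMr // ltrDl.
have oT : open [set: 'cV[R]_n] by exact: openT.
have Cc k i : Ck k setT (fun z : 'cV[R]_n => z i 0).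
  apply: (@Ck_coord _ _ _ _ k setT id i 0 oT).
  elim: k => [|[|k] IH]; first by move=> z _; exact: cvg_id.
    split=> [z _|v z _].
      by apply: ex_diff.
    have -> : (fun x : 'cV[R]_n => 'd id x v) = cst v.
      by apply/funext => x; rewrite diff_val.
    exact: cst_continuous.
  split=> [z _|v]; first by apply: ex_diff.
  apply: (Ck_eq oT _ (Ck_cst k.+1 v oT)) => x _.
  by rewrite diff_val.
have CS k : Ck k setT S.
  apply: (Ck_sum _ oT) => i _.
  have Ci : Ck k setT (fun z : 'cV[R]_n => z i 0 - p i 0).
    exact: (CkB oT (Cc k i) (Ck_cstR k _ oT)).
  by apply: (Ck_eq oT _ (CkM oT Ci Ci)) => z _; rewrite expr2.
exists (fun z => flat 0 (r - S z) * (D z)^-1).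
exists [set z | S z < r / 2].
exists [set z : 'cV[R]_n | forall i, `|z i 0 - p i 0| <= e / 2].
split.
- move=> k.
  have Cr a : Ck k setT (fun z : 'cV[R]_n => a : R) by exact: (Ck_cstR k _ oT).
  have C1 : Ck k setT (fun z => flat 0 (r - S z)).
    exact: (Ck_compR oT (Ck_flat k 0) (CkB oT (Cr r) (CS k))).
  have C2 : Ck k setT (fun z => flat 0 (S z - r / 2)).
    exact: (Ck_compR oT (Ck_flat k 0) (CkB oT (CS k) (Cr (r / 2)))).
  apply: (CkM oT C1); apply: (CkV oT _ (CkD oT C1 C2)) => z _.
  exact: lt0r_neq0 (D0 z).
- split; last first.
    rewrite /= /S big1 ?divr_gt0 // => i _.
    by rewrite subrr expr0n.
  have cS : continuous S by move=> z; exact: (CS 0%N z I).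
  have -> : [set z | S z < r / 2] = S @^-1` [set t | t < r / 2] by [].
  by apply: open_comp => [z _|]; [exact: cS|exact: open_lt].
- move=> z /= Sz; rewrite /D (@flat_le0 _ (S z - r / 2)); last first.
    by rewrite subr_le0 ltW.
  rewrite addr0 divff // gt_eqF // flat_gt0 // subr_gt0.
  by apply: lt_trans Sz _; rewrite ltr_pdivrMr // ltr_pMr // ltrDl.
- split; first exact: compact_box.
  move=> z zK; apply: eO; split => // i j; rewrite ord1.
  rewrite /ball /= distrC; apply: le_lt_trans (zK i) _.
  by rewrite ltr_pdivrMr // ltr_pMr // ltrDl.
- move=> z zK; rewrite flat_le0 ?mul0r // subr_le0 leNgt.
  apply/negP => Sz; apply: zK => i.
  rewrite -ler_sqr ?nnegrE ?divr_ge0 ?(ltW e0) // real_normK ?num_real //.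
  apply: le_trans (ltW Sz); rewrite /S (bigD1 i) //= lerDl.
  by apply: sumr_ge0 => j _; exact: sqr_ge0.
Qed.

End flat.

(** * Charts *)

(** The Lindelof argument: the indices are codes of basic open sets. A basic set contained in some
    open member of [Q] selects such a member, and every other index selects [set0], whence the
    hypothesis [Q set0]. *)
Lemma second_countable_subcover (T : topologicalType) (Q : set T -> Prop) :
  @second_countable T -> Q set0 ->
  (forall x, exists2 V, open V /\ V x & Q V) ->
  exists V : nat -> set T,
    [/\ forall i, open (V i), forall i, Q (V i) & forall x, exists i, V i x].
Proof.
move=> [B /countable_injP [f finj] [Bop Bbasis]] Q0 QV.
have H i : exists V, [/\ open V, Q V & forall b V', B b -> f b = i ->
    b `<=` V' -> open V' -> Q V' -> b `<=` V].
  have [[b [V [Bb fb bV oV qV]]]|nb] := pselect (exists b V,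
      [/\ B b, f b = i, b `<=` V, open V & Q V]).
    exists V; split => // b' V' Bb' fb' _ _ _.
    suff -> : b' = b by [].
    by apply: finj; rewrite ?inE // fb'.
  exists set0; split => //; first exact: open0.
  by move=> b V' Bb fb bV oV qV; exfalso; apply: nb; exists b, V'.
have [V HV] := choice H.
exists V; split.
- by move=> i; have [] := HV i.
- by move=> i; have [] := HV i.
- move=> x; have [U [oU Ux] qU] := QV x.
  have [b [Bb bx] bU] := Bbasis x U (open_nbhs_nbhs (conj oU Ux)).
  exists (f b); have [_ _ h] := HV (f b).
  exact: (h b U).
Qed.

Section charts.
Context {R : realType} {n : nat} {M : topologicalType} (c : chart R n M).

Lemma cinv_continuous_at z : (c @` cdom c) z -> {for z, continuous (cinv c)}.
Proof.
have := @cinv_continuous _ _ _ c.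
rewrite continuous_open_subspace; last exact: cimg_open.
by move=> h cz; apply: h; rewrite inE.
Qed.

Lemma cmap_continuous_at x : cdom c x -> {for x, continuous c}.
Proof.
have := @cmap_continuous _ _ _ c.
rewrite continuous_open_subspace; last exact: cdom_open.
by move=> h cx; apply: h; rewrite inE.
Qed.

Lemma chart_imageE (U : set M) :
  c @` (cdom c `&` U) = (c @` cdom c) `&` (cinv c @^-1` U).
Proof.
apply/seteqP; split => [_ [x [dx Ux] <-]|_ [[x dx <-]] /=].
  by split; [exists x|rewrite /= cmapK].
by rewrite cmapK // => Ux; exists x.
Qed.

Lemma chart_image_open (U : set M) : open U -> open (c @` (cdom c `&` U)).
Proof.
rewrite chart_imageE !openE => oU z [cz Uz]; apply: filterI.
  by apply: open_nbhs_nbhs; split => //; exact: cimg_open.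
by apply: (cinv_continuous_at cz); exact: oU.
Qed.

Lemma chart_preimage_open (O : set 'cV[R]_n) : open O ->
  open (cdom c `&` (c @^-1` O)).
Proof.
rewrite !openE => oO x [cx Ox]; apply: filterI.
  by apply: open_nbhs_nbhs; split => //; exact: cdom_open.
by apply: (cmap_continuous_at cx); exact: oO.
Qed.

End charts.

Section manifold.
Context {R : realType} {n : nat} {M : manifold R n}.

Definition smooth_fun (U : set M) (phi : M -> R) : Prop :=
  forall c, atlas c -> smooth (c @` (cdom c `&` U)) (phi \o cinv c).

Lemma transition_diff (c c' : chart R n M) x : atlas c -> atlas c' ->
  cdom c x -> cdom c' x -> differentiable (c' \o cinv c) (c x).
Proof.
move=> ac ac' cx c'x; have [d _] := atlas_smooth ac ac' 1%N.
by apply: d; exists x.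
Qed.

(** This is the chain rule for the composite of two opposite changes of charts. The composite is the
    identity only near [c x], which suffices by [near_eq_diff]. *)
Lemma transition_diffK (c c' : chart R n M) x : atlas c -> atlas c' ->
  cdom c x -> cdom c' x ->
  cancel ('d (c' \o cinv c) (c x)) ('d (c \o cinv c') (c' x)).
Proof.
move=> ac ac' cx c'x v.
have df := transition_diff ac ac' cx c'x.
have dg : differentiable (c \o cinv c') ((c' \o cinv c) (c x)).
  by rewrite /= cmapK //; exact: transition_diff.
have near_id : \forall z \near c x, z = ((c \o cinv c') \o (c' \o cinv c)) z.
  have o : open (c @` (cdom c `&` cdom c')).
    by apply: chart_image_open; exact: cdom_open.
  have m : (c @` (cdom c `&` cdom c')) (c x) by exists x.
  apply: filterS (open_nbhs_nbhs (conj o m)) => _ [y [cy c'y] <-] /=.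
  by rewrite cmapK // cmapK.
have [_ e] := near_eq_diff near_id (@ex_diff _ _ _ _ _ _ _ (is_diff_id (c x))).
have e2 : 'd ((c \o cinv c') \o (c' \o cinv c)) (c x) v = v.
  by rewrite (congr1 (fun h => h v) e) (@diff_val _ _ _ _ _ _ _ (is_diff_id (c x))).
have fE : (c' \o cinv c) (c x) = c' x by rewrite /= cmapK.
have e3 := congr1 (fun h => h v) (diff_comp df dg).
by move: e3; rewrite fE => e3; exact: (etrans (esym e3) e2).
Qed.

Lemma tcoordK (c : chart R n M) x : atlas c -> cdom c x ->
  cancel (@tcoord R n M c x) (@tvect R n M c x).
Proof.
move=> ac cx; apply: transition_diffK => //; first exact: chart_at_atlas.
exact: chart_at_dom.
Qed.

Lemma tvectK (c : chart R n M) x : atlas c -> cdom c x ->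
  cancel (@tvect R n M c x) (@tcoord R n M c x).
Proof.
move=> ac cx; apply: transition_diffK => //; first exact: chart_at_atlas.
exact: chart_at_dom.
Qed.

Lemma smooth_fun_local U phi :
  (forall x, U x -> exists2 O, open O /\ O x & smooth_fun O phi) ->
  smooth_fun U phi.
Proof.
move=> H c ac k; apply: Ck_local => _ [x [cx Ux] <-].
have [B [oB Bx] sB] := H x Ux.
by exists (c @` (cdom c `&` B)); [exists x|exact: sB].
Qed.

Lemma smooth_fun_eq U phi psi : open U -> (forall x, U x -> phi x = psi x) ->
  smooth_fun U phi -> smooth_fun U psi.
Proof.
move=> oU e sf c ac k; apply: Ck_eq (sf c ac k); first exact: chart_image_open.
by move=> _ [x [cx Ux] <-] /=; rewrite cmapK // e.
Qed.

Lemma smooth_fun_cst U a : open U -> smooth_fun U (fun=> a).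
Proof.
move=> oU c ac k; have o := chart_image_open (c := c) oU.
exact: (Ck_cstR k _ o).
Qed.

Lemma smooth_funD U phi psi : open U -> smooth_fun U phi -> smooth_fun U psi ->
  smooth_fun U (fun x => phi x + psi x).
Proof.
move=> oU s1 s2 c ac k; have o := chart_image_open (c := c) oU.
exact: (CkD o (s1 c ac k) (s2 c ac k)).
Qed.

Lemma smooth_funM U phi psi : open U -> smooth_fun U phi -> smooth_fun U psi ->
  smooth_fun U (fun x => phi x * psi x).
Proof.
move=> oU s1 s2 c ac k; have o := chart_image_open (c := c) oU.
exact: (CkM o (s1 c ac k) (s2 c ac k)).
Qed.

(* The only use of the Hausdorff axiom: the compact support is closed, so that the
   extension by zero is smooth. *)
Lemma manifold_bump (x : M) (U : set M) : open U -> U x ->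
  exists (phi : M -> R) (V K : set M),
    [/\ smooth_fun setT phi, open V /\ V x, forall y, V y -> phi y = 1,
        closed K /\ K `<=` U & forall y, ~ K y -> phi y = 0].
Proof.
move=> oU Ux; set c := chart_at x.
have ac : atlas c := chart_at_atlas x.
have cx : cdom c x := chart_at_dom x.
have o := chart_image_open (c := c) oU.
have m : (c @` (cdom c `&` U)) (c x) by exists x.
have [h [V [K [sh [oV Vx] hV [cK KU] hK]]]] :=
  bump_exists (open_nbhs_nbhs (conj o m)).
have closedK : closed (cinv c @` K).
  apply: compact_closed; first exact: manifold_hausdorff.
  apply: continuous_compact => //.
  apply: continuous_subspaceW (@cinv_continuous _ _ _ c).
  by move=> z /KU [y [cy _] <-]; exists y.
pose phi y := if `[< cdom c y >] then h (c y) else 0.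
have phi0 y : ~ (cinv c @` K) y -> phi y = 0.
  move=> yK; rewrite /phi; case: asboolP => // cy; apply: hK => Ky.
  by apply: yK; exists (c y) => //; rewrite cmapK.
exists phi, (cdom c `&` (c @^-1` V)), (cinv c @` K); split => //.
- apply: smooth_fun_local => y _.
  have [cy|cy] := pselect (cdom c y).
    exists (cdom c); first by split => //; exact: cdom_open.
    move=> c' ac' k; have o' := chart_image_open (c := c') (cdom_open c).
    have := @Ck_comp _ _ _ k _ setT _ _ o' openT (fun _ _ => I) (sh k)
      (atlas_smooth ac' ac k).
    apply: Ck_eq => // _ [z [cz c'z] <-] /=.
    rewrite cmapK // /phi; case: asboolP => //.
  exists (~` (cinv c @` K)).
    split; first exact: closed_openC.
    by move=> [z /KU [w [cw _] <-]]; rewrite cmapK // => e; rewrite e in cw.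
  apply: (@smooth_fun_eq _ (fun=> 0)) => [|z /phi0 -> //|].
    exact: closed_openC.
  by apply: smooth_fun_cst; exact: closed_openC.
- by split => //; exact: chart_preimage_open.
- by move=> y [cy Vy]; rewrite /phi; case: asboolP => // _; exact: hV.
- by split => // _ [z /KU [w [cw Uw] <-] <-]; rewrite cmapK.
Qed.

End manifold.

(** * Tensor fields *)

Lemma linear_mulmxE (R : comNzRingType) m n (f : {linear 'cV[R]_n -> 'cV[R]_m}) :
  exists J : 'M[R]_(m, n), forall v, f v = J *m v.
Proof.
exists (\matrix_(i, j) f (delta_mx j 0) i 0) => v.
rewrite -linear_colE; apply/colP => i; rewrite summxE mxE.
by apply: eq_bigr => j _; rewrite !mxE mulrC.
Qed.

Section Ck_matrix.
Context {R : realType} {V : normedModType R}.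

Lemma Ck_det n k (U : set V) (A : V -> 'M[R]_n) : open U ->
  (forall i j, Ck k U (fun x => A x i j)) -> Ck k U (fun x => \det (A x)).
Proof.
move=> oU cA; rewrite /determinant; apply: (Ck_sum _ oU) => s _.
apply: (CkM oU (Ck_cstR k _ oU)).
by apply: (Ck_prod _ oU) => i _; exact: cA.
Qed.

(** By the adjugate formula the entries of the inverse are polynomials in those of [A], divided by a
    determinant that has no zero on [U]. *)
Lemma Ck_invmx n k (U : set V) (A : V -> 'M[R]_n) : open U ->
  (forall x, U x -> A x \in unitmx) ->
  (forall i j, Ck k U (fun x => A x i j)) ->
  forall i j, Ck k U (fun x => invmx (A x) i j).
Proof.
move=> oU uA cA i j.
apply: (@Ck_eq _ _ _ k U (fun x => (\det (A x))^-1 *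
  ((-1) ^+ (j + i) * \det (row' j (col' i (A x))))) _ oU).
  by move=> x Ux; rewrite /invmx (uA x Ux) !mxE.
apply: (CkM oU (CkV oU _ (Ck_det oU cA))).
  by move=> x /uA; rewrite unitmxE unitfE.
apply: (CkM oU (Ck_cstR k _ oU)).
apply: (Ck_det oU) => i' j'.
apply: (Ck_eq oU _ (cA (lift j i') (lift i j'))) => x _.
by rewrite !mxE.
Qed.

Lemma Ck_mulmx m n k (U : set V) (A : V -> 'M[R]_(m, n)) (v : V -> 'cV[R]_n) :
  open U -> (forall i j, Ck k U (fun x => A x i j)) ->
  (forall j, Ck k U (fun x => v x j 0)) ->
  forall i, Ck k U (fun x => (A x *m v x) i 0).
Proof.
move=> oU cA cv i; apply: (@Ck_eq _ _ _ k U (fun x => \sum_j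
  A x i j * v x j 0) _ oU) => [x _|]; first by rewrite mxE.
by apply: (Ck_sum _ oU) => j _; exact: (CkM oU (cA i j) (cv j)).
Qed.

Lemma Ck_eta n k (U : set V) (v w : V -> 'cV[R]_n.+2) : open U ->
  (forall j, Ck k U (fun x => v x j 0)) ->
  (forall j, Ck k U (fun x => w x j 0)) ->
  Ck k U (fun x => eta (v x) (w x)).
Proof.
move=> oU cv cw.
apply: (CkD oU); first by apply: (CkD oU); apply: (CkM oU).
by apply: (Ck_sum _ oU) => i _; apply: (CkM oU).
Qed.

End Ck_matrix.

Section eta.
Context {R : realType} {n : nat}.
Implicit Types (u v w : 'cV[R]_n.+2).

Lemma etaC v w : eta v w = eta w v.
Proof.
rewrite /eta [v 0 0 * _]mulrC [v 1 0 * _]mulrC [X in X + _]addrC; congr (_ + _).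
by apply: eq_bigr => i _; rewrite mulrC.
Qed.

Lemma eta_linearl w : scalar (fun v : 'cV[R]_n.+2 => eta v w).
Proof.
move=> a u v; rewrite /eta !mxE.
under eq_bigr do rewrite !mxE mulrDl -mulrA.
rewrite big_split /= -mulr_sumr /GRing.scale /=; ring.
Qed.

Lemma eta_linearr v : scalar (fun w : 'cV[R]_n.+2 => eta v w).
Proof. by move=> a u w; rewrite etaC eta_linearl ![eta _ v]etaC. Qed.

Lemma eta_kvec v : eta (kvec R n) v = v 1 0.
Proof.
rewrite /eta /kvec !mxE !eqxx /= mul1r mul0r addr0 big1 ?addr0 // => i i1.
rewrite !mxE; case: eqP => [e|_]; last by rewrite mul0r.
by rewrite e in i1.
Qed.

End eta.

Section tensors.
Context {R : realType} {n : nat} {M : manifold R n}.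
Implicit Types (U : set M) (g h : tensor2 M).

(** The smoothness clause of [symmetric_tensor_field], relative to [U]: a local section of [P]
    yields a tensor that is smooth on an open set only. *)
Definition smooth_tensor U g := forall c, atlas c -> forall v w : 'cV[R]_n,
  smooth (c @` (cdom c `&` U)) (fun z : 'cV[R]_n =>
    g (cinv c z) (tvect c (cinv c z) v) (tvect c (cinv c z) w) : R^o).

Lemma smooth_tensor_local U g :
  (forall x, U x -> exists2 B, open B /\ B x & smooth_tensor B g) ->
  smooth_tensor U g.
Proof.
move=> H c ac v w k; apply: Ck_local => _ [x [cx Ux] <-].
have [B [oB Bx] sB] := H x Ux.
by exists (c @` (cdom c `&` B)); [exists x|exact: sB].
Qed.

Lemma smooth_tensor_eq U g h : open U -> (forall x, U x -> g x = h x) ->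
  smooth_tensor U g -> smooth_tensor U h.
Proof.
move=> oU e sg c ac v w k; apply: Ck_eq (sg c ac v w k).
  exact: chart_image_open.
by move=> _ [x [cx Ux] <-]; rewrite cmapK // e.
Qed.

Lemma smooth_tensor_sub U U' g : U' `<=` U -> smooth_tensor U g ->
  smooth_tensor U' g.
Proof.
move=> UU' sg c ac v w k; apply: Ck_sub (sg c ac v w k).
by move=> _ [x [cx /UU' Ux] <-]; exists x.
Qed.

Definition scalet (phi : M -> R) g : tensor2 M := fun x v w => phi x * g x v w.

Lemma smooth_scalet U phi g : open U -> smooth_fun U phi ->
  smooth_tensor U g -> smooth_tensor U (scalet phi g).
Proof.
move=> oU sp sg c ac v w k; have o := chart_image_open (c := c) oU.
exact: (CkM o (sp c ac k) (sg c ac v w k)).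
Qed.

Definition bilinear_symmetric g := [/\
  forall (x : M) (w : 'cV[R]_n), scalar (fun v : 'cV[R]_n => g x v w),
  forall (x : M) (v : 'cV[R]_n), scalar (fun w : 'cV[R]_n => g x v w) &
  forall (x : M) (v w : tangent x), g x v w = g x w v].

Lemma symmetric_tensor_fieldP g :
  symmetric_tensor_field g <-> bilinear_symmetric g /\ smooth_tensor setT g.
Proof.
split=> [[gl gr gs gc]|[[gl gr gs] gc]]; split => //.
  by move=> c ac v w; rewrite setIT; exact: gc.
by move=> c ac v w; have := gc c ac v w; rewrite setIT.
Qed.

Lemma bilinear_scalet phi g :
  bilinear_symmetric g -> bilinear_symmetric (scalet phi g).
Proof.
move=> [gl gr gs]; split => [x w a u v|x v a u w|x v w]; rewrite /scalet.
- by rewrite gl /GRing.scale /=; ring.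
- by rewrite gr /GRing.scale /=; ring.
- by rewrite gs.
Qed.

Lemma stf_scalet phi g : smooth_fun setT phi ->
  symmetric_tensor_field g -> symmetric_tensor_field (scalet phi g).
Proof.
move=> sp /symmetric_tensor_fieldP [bg sg]; apply/symmetric_tensor_fieldP.
by split; [exact: bilinear_scalet|exact: (smooth_scalet openT sp sg)].
Qed.

Lemma stf_addt g h : symmetric_tensor_field g -> symmetric_tensor_field h ->
  symmetric_tensor_field (addt g h).
Proof.
move=> /symmetric_tensor_fieldP [[gl gr gs] gc].
move=> /symmetric_tensor_fieldP [[hl hr hs] hc].
apply/symmetric_tensor_fieldP; split.
  split => [x w a u v|x v a u w|x v w]; rewrite /addt.
  - by rewrite gl hl /GRing.scale /=; ring.
  - by rewrite gr hr /GRing.scale /=; ring.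
  - by rewrite gs hs.
move=> c ac v w k; have o := chart_image_open (c := c) openT.
exact: (CkD o (gc c ac v w k) (hc c ac v w k)).
Qed.

Lemma subtE g h : subt g h = addt g (scalet (fun=> -1) h).
Proof.
by apply/functional_extensionality_dep => x; apply/funext => v; apply/funext => w;
  rewrite /subt /addt /scalet mulN1r.
Qed.

Lemma tcoord_mulmxE (c : chart R n M) x :
  exists J : 'M[R]_n, forall v : 'cV[R]_n, @tcoord R n M c x v = J *m v.
Proof. exact: linear_mulmxE. Qed.

Lemma tvect_mulmxE (c : chart R n M) x :
  exists J : 'M[R]_n, forall v : 'cV[R]_n, @tvect R n M c x v = J *m v.
Proof. exact: linear_mulmxE. Qed.

(** The entries of [s x] need not be smooth in [x], even for a smooth frame field: they refer to
    [chart_at x], which may jump. In a fixed chart [c] this defect disappears. *)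
Definition frame_matrix (c : chart R n M) (s : M -> 'M[R]_n) (z : 'cV[R]_n) :=
  \matrix_(i, j) (@tcoord R n M c (cinv c z)
     (fapp (cinv c z) (s (cinv c z)) (delta_mx j 0))) i 0.

(** With [J] the Jacobian behind [tcoord] and [T] its inverse, behind [tvect], the matrix is J s(x),
    with inverse s(x)^-1 T. Frame coordinates of a vector constant in the chart are thus expressed
    by a matrix with smooth entries. *)
Lemma frame_matrixE c s x : atlas c -> cdom c x -> s x \in unitmx ->
  frame_matrix c s (c x) \in unitmx /\
  forall v : 'cV[R]_n, invmx (frame_matrix c s (c x)) *m v =
    invmx (s x) *m @tvect R n M c x v.
Proof.
move=> ac cx us; have [J hJ] := tcoord_mulmxE c x.
have [T hT] := tvect_mulmxE c x.
have JT : J *m T = 1%:M.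
  apply/matrixP => i j.
  have := tvectK ac cx (delta_mx j 0); rewrite hJ hT => /colP /(_ i).
  by rewrite mulmxA -colE !mxE eqxx andbT.
have -> : frame_matrix c s (c x) = J *m s x.
  apply/matrixP => i j; rewrite mxE cmapK // hJ /fapp mulmxA -colE mxE.
  by [].
have [uJ _] := mulmx1_unit JT.
have uA : J *m s x \in unitmx by rewrite unitmx_mul uJ us.
split => // v; rewrite hT.
apply: (can_inj (mulKmx uA)); rewrite mulKVmx // -mulmxA mulKVmx //.
by rewrite mulmxA JT mul1mx.
Qed.

End tensors.

Section pullback.
Context {R : realType} {n : nat} {M : manifold R n.+2}.

Definition frame_metric (s : M -> 'M[R]_n.+2) : tensor2 M :=
  fun x v w => eta (invmx (s x) *m v) (invmx (s x) *m w).

Lemma bilinear_frame_metric s : bilinear_symmetric (frame_metric s).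
Proof.
split => [x w a u v|x v a u w|x v w]; rewrite /frame_metric.
- by rewrite mulmxDr -scalemxAr eta_linearl.
- by rewrite mulmxDr -scalemxAr eta_linearr.
- exact: etaC.
Qed.

Lemma smooth_frame_metric (U : set M) s : open U -> smooth_frame_field U s ->
  (forall x, U x -> s x \in unitmx) -> smooth_tensor U (frame_metric s).
Proof.
move=> oU ss us c ac v w k; have o := chart_image_open (c := c) oU.
apply: (@Ck_eq _ _ _ k _ (fun z => eta (invmx (frame_matrix c s z) *m v)
   (invmx (frame_matrix c s z) *m w)) _ o).
  move=> _ [x [cx Ux] <-]; have [_ e] := frame_matrixE ac cx (us x Ux).
  by rewrite !e /frame_metric cmapK.
have H (y : 'cV[R]_n.+2) i :
    Ck k (c @` (cdom c `&` U)) (fun z => (invmx (frame_matrix c s z) *m y) i 0).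
  apply: (@Ck_mulmx _ _ _ _ k _ _ (fun=> y) o); last first.
    by move=> j; exact: (Ck_cstR k _ o).
  apply: (Ck_invmx o) => [_ [x [cx Ux] <-]|i' j].
    by have [] := frame_matrixE ac cx (us x Ux).
  apply: (Ck_eq o _ (Ck_coord i' 0 o (ss (delta_mx j 0) c ac k))) => z _.
  by rewrite mxE.
exact: (Ck_eta o (H v) (H w)).
Qed.

End pullback.

(** * Gluing *)

Section agreement.
Context {R : realType} {n : nat} {M : manifold R n.+2}.
Variable P : M -> set 'M[R]_n.+2.

Record agrees (phi : M -> R) (g : tensor2 M) : Prop := Agrees {
  agrees_stf : symmetric_tensor_field g;
  agrees_kvec : forall x u z, P x u ->
    g x (u *m kvec R n) (u *m z) = phi x * eta (kvec R n) z;
  agrees_kperp : forall x u w w', P x u -> kperp w -> kperp w' ->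
    g x (u *m w) (u *m w') = phi x * eta w w' }.

Lemma agrees_addt phi psi g h : agrees phi g -> agrees psi h ->
  agrees (fun x => phi x + psi x) (addt g h).
Proof.
move=> [g1 g2 g3] [h1 h2 h3]; split; first exact: stf_addt.
  by move=> x u z Pu; rewrite /addt g2 // h2 // mulrDl.
by move=> x u w w' Pu kw kw'; rewrite /addt g3 // h3 // mulrDl.
Qed.

Lemma agrees_scalet a phi g : smooth_fun setT a -> agrees phi g ->
  agrees (fun x => a x * phi x) (scalet a g).
Proof.
move=> sa [g1 g2 g3]; split; first exact: stf_scalet.
  by move=> x u z Pu; rewrite /scalet g2 // mulrA.
by move=> x u w w' Pu kw kw'; rewrite /scalet g3 // mulrA.
Qed.

Hypothesis hP : GN_structure P.

Lemma agrees0 : agrees (fun=> 0) (fun x v w => 0).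
Proof.
split=> [|x u z _|x u w w' _ _ _]; rewrite ?mul0r //.
apply/symmetric_tensor_fieldP; split.
  by split => // [x w a u v|x v a u w]; rewrite /GRing.scale /= mulr0 addr0.
move=> c ac v w k; apply: Ck_cstR.
by apply: chart_image_open; exact: openT.
Qed.

Lemma agrees_local x : exists (V : set M) (phi : M -> R) (g : tensor2 M),
  [/\ open V /\ V x, smooth_fun setT phi, forall y, V y -> phi y = 1 &
      agrees phi g].
Proof.
have [U [s [oU Ux ss Ps]]] := psb_section hP x.
have [phi [V [K [sp oV phi1 [cK KU] phi0]]]] := manifold_bump oU Ux.
have us y : U y -> s y \in unitmx by move=> /Ps /(psb_frame hP).
(* Outside [U] nothing is known of [s], whose values may be singular; there the weight and the
   tensor vanish together. *)
have phiE y : U y \/ phi y = 0.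
  have [/KU|/phi0] := pselect (K y); by [left|right].
exists V, phi, (scalet phi (frame_metric s)); split => //; split.
- apply/symmetric_tensor_fieldP; split.
    exact/bilinear_scalet/bilinear_frame_metric.
  apply: smooth_tensor_local => y _; have [Uy|Uy] := pselect (U y).
    exists U => //; apply: smooth_scalet => //; last exact: smooth_frame_metric.
    by move=> c ac k; apply: Ck_sub (sp c ac k) => _ [z [cz _] <-]; exists z.
  exists (~` K); first by split; [exact: closed_openC|move=> /KU].
  apply: (@smooth_tensor_eq _ _ _ _ (fun x v w => 0)).
  + exact: closed_openC.
  + move=> z Kz; apply/funext => v; apply/funext => w.
    by rewrite /scalet phi0 // mul0r.
  + move=> c ac v w k; apply: Ck_cstR.
    by apply: chart_image_open; exact: closed_openC.
- move=> y u z Pu; rewrite /scalet; have [Uy|->] := phiE y; last by rewrite !mul0r.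
  (* Any frame of [P] at [y] is s(y) f with f in [GN]. The factor s(y) cancels, and a defining
     clause of [GN] remains. *)
  congr (_ * _); have [f [uf fk fp fz] ->] := psb_transitive hP (Ps y Uy) Pu.
  by rewrite /frame_metric -!mulmxA !mulKmx ?us.
- move=> y u w w' Pu kw kw'; rewrite /scalet.
  have [Uy|->] := phiE y; last by rewrite !mul0r.
  congr (_ * _); have [f [uf fk fp fz] ->] := psb_transitive hP (Ps y Uy) Pu.
  by rewrite /frame_metric -!mulmxA !mulKmx ?us // fp.
Qed.

(* The weights [phi_m * \prod_(i < m) (1 - phi_i)] of the tensors [h m] add up to 1,
   and they vanish from the index [i.+1] on, at the points where [phi_i] is 1.
   Hence no paracompactness is needed: the sums become stationary on each set of a
   countable cover. *)
Fixpoint glue (phi : nat -> M -> R) (h : nat -> tensor2 M) (m : nat) :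
    (M -> R) * tensor2 M :=
  if m is m'.+1 then
    let: (psi, g) := glue phi h m' in
    (fun x => psi x + (1 - psi x) * phi m' x,
     addt g (scalet (fun x => 1 - psi x) (h m')))
  else (fun=> 0, fun x v w => 0).

Lemma glue_agrees phi h m : (forall i, smooth_fun setT (phi i)) ->
  (forall i, agrees (phi i) (h i)) ->
  smooth_fun setT (glue phi h m).1 /\ agrees (glue phi h m).1 (glue phi h m).2.
Proof.
move=> sphi hh; elim: m => [|m /=].
  by split; [apply: smooth_fun_cst; exact: openT|exact: agrees0].
case: (glue phi h m) => psi g /= [sg ag].
have s1 : smooth_fun setT (fun x => 1 - psi x).
  apply: (@smooth_fun_eq _ _ _ setT (fun x => 1 + -1 * psi x)).
  - exact: openT.
  - by move=> x _; rewrite mulN1r.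
  apply: smooth_funD; first exact: openT.
    by apply: smooth_fun_cst; exact: openT.
  apply: smooth_funM; first exact: openT.
    by apply: smooth_fun_cst; exact: openT.
  exact: sg.
split; last by apply: agrees_addt => //; exact: agrees_scalet.
by do 2?[apply: smooth_funD || apply: smooth_funM] => //; exact: openT.
Qed.

Lemma glue_one phi h i x : phi i x = 1 -> forall m, (i < m)%N ->
  (glue phi h m).1 x = 1 /\ (glue phi h m).2 x = (glue phi h i.+1).2 x.
Proof.
move=> p1; elim=> // m IH; rewrite ltnS leq_eqVlt => /orP[/eqP <-|/IH] /=.
  by case: (glue phi h i) => psi g /=; rewrite p1 mulr1 addrC subrK.
case: (glue phi h m) => psi g /= [e1 e2]; rewrite e1 subrr mul0r addr0; split=> //.
rewrite -e2; apply/funext => v; apply/funext => w.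
by rewrite /addt /scalet e1 subrr mul0r addr0.
Qed.

Lemma agrees1_exists : exists g : tensor2 M, agrees (fun=> 1) g.
Proof.
pose Q (V : set M) := exists ph : (M -> R) * tensor2 M,
  [/\ smooth_fun setT ph.1, forall y, V y -> ph.1 y = 1 & agrees ph.1 ph.2].
have Q0 : Q set0.
  exists (fun=> 0, fun x v w => 0); split => //=; last exact: agrees0.
  by apply: smooth_fun_cst; exact: openT.
have QV x : exists2 V, open V /\ V x & Q V.
  have [V [phi [g [oV sp p1 ag]]]] := agrees_local x.
  by exists V => //; exists (phi, g).
have [V [oV + Vx]] :=
  second_countable_subcover (@manifold_second_countable _ _ M) Q0 QV.
move=> /choice [ph Hph]; have [j Vj] := choice Vx.
pose phi i := (ph i).1; pose h i := (ph i).2.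
have sphi i : smooth_fun setT (phi i) by have [] := Hph i.
have ah i : agrees (phi i) (h i) by have [] := Hph i.
have phi1 i y : V i y -> phi i y = 1 by have [_ + _] := Hph i; apply.
pose G m := (glue phi h m).2.
have aG m : agrees (glue phi h m).1 (G m) by have [] := glue_agrees m sphi ah.
(* The index [j y] is an arbitrary choice and may jump with [y]. Comparison with a common later
   stage [m] shows that on [V i] the glued tensor is the fixed [G i.+1], which gives smoothness. *)
have GE i y : V i y -> G (j y).+1 y = G i.+1 y.
  move=> Viy; rewrite /G; pose m := (maxn i (j y)).+1.
  have [_ <-] := glue_one h (phi1 _ _ Viy) (m := m) (leq_maxl _ _).
  by have [_ <-] := glue_one h (phi1 _ _ (Vj y)) (m := m) (leq_maxr _ _).
have one y : (glue phi h (j y).+1).1 y = 1.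
  by have [] := glue_one h (phi1 _ _ (Vj y)) (ltnSn _).
exists (fun x => G (j x).+1 x); split.
- apply/symmetric_tensor_fieldP; split.
    split=> [x w|x v|x v w]; have [[a b c d] _ _] := aG (j x).+1;
      [exact: a|exact: b|exact: c].
  apply: smooth_tensor_local => x _; exists (V (j x)) => //.
  apply: (@smooth_tensor_eq _ _ _ _ (G (j x).+1)) => // [y Vy|].
    by rewrite (GE _ _ Vy).
  have [/symmetric_tensor_fieldP [_ sG] _ _] := aG (j x).+1.
  exact: smooth_tensor_sub sG.
- by move=> x u z Pu; have [_ -> // _] := aG (j x).+1; rewrite one.
- by move=> x u w w' Pu kw kw'; have [_ _ -> //] := aG (j x).+1; rewrite one.
Qed.

End agreement.

(** * Null frames *)

Lemma sum_ord3 (V : nmodType) n (F : 'I_n.+2 -> V) :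
  \sum_i F i = F 0 + F 1 + \sum_(i < n.+2 | (1 < i)%N) F i.
Proof.
rewrite (bigD1 0) //= (bigD1 1) //= addrA; congr (_ + _).
by apply: eq_bigl => -[[|[|m]] Hm].
Qed.

Lemma scalar_colE (R : comNzRingType) m (f : 'cV[R]_m -> R) (v : 'cV[R]_m) :
  scalar f -> f v = \sum_i v i 0 * f (delta_mx i 0).
Proof.
move=> fl; pose fM := GRing.isLinear.Build _ _ _ _ f fl.
pose fL : {scalar 'cV[R]_m} := HB.pack f fM.
rewrite -[f v]/(fL v) {1}(matrix_sum_delta v) linear_sum; apply: eq_bigr => i _.
by rewrite big_ord1 linearZ.
Qed.

Lemma scalarDZ (R : comNzRingType) (V : lmodType R) (f : V -> R) : scalar f ->
  {morph f : x y / x + y} /\ forall a, {morph f : x / a *: x >-> a * x}.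
Proof.
move=> fl; pose fM := GRing.isLinear.Build _ _ _ _ f fl.
pose fL : {scalar V} := HB.pack f fM.
by split=> [x y|a x]; [exact: (linearD fL)|exact: (linearZ_LR fL)].
Qed.

Section transvection.
Context {R : fieldType} {n : nat}.
Implicit Types (t : 'cV[R]_n) (d : 'rV[R]_n).

Definition transvection t d : 'M[R]_n := 1%:M + t *m d.

Lemma transvectionE t d v : transvection t d *m v = v + (d *m v) 0 0 *: t.
Proof.
rewrite /transvection mulmxDl mul1mx -mulmxA; congr (_ + _).
by rewrite [d *m v]mx11_scalar mul_mx_scalar !mxE.
Qed.

(** The matrix t d squares to zero, so 1 - t d is inverse to 1 + t d. *)
Lemma transvection_unit t d : d *m t = 0 -> transvection t d \in unitmx.
Proof.
move=> dt; suff /mulmx1_unit [] :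
  transvection t d *m transvection (- t) d = 1%:M by [].
rewrite /transvection mulmxDl mul1mx mulmxDr mulmx1 mulmxA -[t *m d *m _]mulmxA.
by rewrite mulmxN dt oppr0 mulmx0 mul0mx addr0 mulNmx subrK.
Qed.

End transvection.

Section eta_basis.
Context {R : realType} {n : nat}.
Implicit Types (v w : 'cV[R]_n.+2).

Definition lvec : 'cV[R]_n.+2 := delta_mx 1 0.

Lemma kperpE v : kperp v <-> v 1 0 = 0.
Proof. by rewrite /kperp /= eta_kvec. Qed.

Lemma kperp_kvec : kperp (kvec R n).
Proof. by rewrite kperpE mxE. Qed.

Lemma kperp_proj v : kperp (v - v 1 0 *: lvec).
Proof. by rewrite kperpE !mxE !eqxx mulr1 subrr. Qed.

Lemma eta_lvec v : eta lvec v = v 0 0.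
Proof.
rewrite /eta /lvec !mxE !eqxx /= mul1r mul0r add0r big1 ?addr0 // => i i1.
rewrite !mxE; case: eqP => [e|_]; last by rewrite mul0r.
by rewrite e in i1.
Qed.

Lemma row1E v : (delta_mx 0 1 : 'rV[R]_n.+2) *m v = (v 1 0)%:M.
Proof.
by apply/matrixP => i j; rewrite -rowE !ord1 !mxE eqxx mulr1n.
Qed.

Lemma row0E v : (delta_mx 0 0 : 'rV[R]_n.+2) *m v = (v 0 0)%:M.
Proof.
by apply/matrixP => i j; rewrite -rowE !ord1 !mxE eqxx mulr1n.
Qed.

Lemma eta_diag : exists2 b : 'M[R]_n.+2, b \in unitmx &
  forall i j, eta (b *m delta_mx i 0) (b *m delta_mx j 0) =
    if i == j then (if i == ord0 then -1 else 1) else 0.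
Proof.
(* The basis [k - l / 2], [k + l / 2], [m_i]. *)
pose b := transvection (- 2^-1 *: lvec) (delta_mx 0 0) *m
          transvection (kvec R n) (delta_mx 0 1).
have bE v : b *m v = v + v 1 0 *: kvec R n - (2^-1 * (v 0 0 + v 1 0)) *: lvec.
  rewrite /b -mulmxA !transvectionE row1E row0E !mxE !eqxx !mulr1n mulr1.
  by rewrite scalerA mulrN scaleNr mulrC.
exists b.
  rewrite unitmx_mul !transvection_unit //.
    by rewrite row1E mxE -scalemx1 scale0r.
  by rewrite row0E !mxE mulr0 -scalemx1 scale0r.
move=> i j; set v := delta_mx i 0; set w := delta_mx j 0.
(* In the new basis [eta] is the Euclidean product with the sign of the first coordinate
   reversed. *)
have -> : eta (b *m v) (b *m w) = \sum_k v k 0 * w k 0 - 2 * v 0 0 * w 0 0.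
  have b0 (y : 'cV[R]_n.+2) : (b *m y) 0 0 = y 0 0 + y 1 0.
    by rewrite bE !mxE /= mulr0 subr0 mulr1.
  have b1 (y : 'cV[R]_n.+2) : (b *m y) 1 0 = y 1 0 - 2^-1 * (y 0 0 + y 1 0).
    by rewrite bE !mxE /= mulr0 addr0 mulr1.
  have b2 (y : 'cV[R]_n.+2) (k : 'I_n.+2) : (1 < k)%N -> (b *m y) k 0 = y k 0.
    by case: k => [[|[|m]] Hm] // _; rewrite bE !mxE /= !mulr0 subr0 addr0.
  rewrite sum_ord3 /eta !b0 !b1.
  under eq_bigr => k k1 do rewrite !(b2 _ _ k1).
  by field.
rewrite (bigD1 i) //= big1 ?addr0 => [|k ki]; last first.
  by rewrite !mxE (negbTE ki) mul0r.
rewrite !mxE !eqxx !andbT mul1r [0 == i]eq_sym.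
have [->|ij] := eqVneq i j.
  by have [e|e] := eqVneq j ord0; rewrite ?eqxx /= ?mulr1 ?mulr0 ?subr0 //; ring.
have [e|e] := eqVneq i 0; last by rewrite mulr0 mul0r subr0.
by move: ij; rewrite e => /negbTE ->; rewrite mulr0 subr0.
Qed.

End eta_basis.

Section null_correction.
Context {R : realType} {n : nat} (B : 'cV[R]_n.+2 -> 'cV[R]_n.+2 -> R).

(* The isotropic vector completing [k, m_i] is [lvec + corr_vec]: the components on
   [m_i] make it orthogonal to [m_i], and the one on [k] then makes it null. *)
Definition corr_vec : 'cV[R]_n.+2 := \col_i
  if i == 0 then
    2^-1 * (\sum_(j < n.+2 | (1 < j)%N) B lvec (delta_mx j 0) ^+ 2 - B lvec lvec)
  else if i == 1 then 0 else - B lvec (delta_mx i 0).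

(** The row [delta_mx 0 1] is the covector eta(k, -). Hence k^perp is fixed pointwise and [lvec]
    goes to [lvec + corr_vec]; invertibility comes from [corr_vec] lying in k^perp. *)
Definition corr_mx := transvection corr_vec (delta_mx 0 1).

Lemma corr_mxE v : corr_mx *m v = v + v 1 0 *: corr_vec.
Proof. by rewrite transvectionE row1E !mxE eqxx mulr1n. Qed.

Lemma corr_vec1 : corr_vec 1 0 = 0.
Proof. by rewrite mxE. Qed.

Lemma corr_mx_unit : corr_mx \in unitmx.
Proof.
by apply: transvection_unit; rewrite row1E corr_vec1 -scalemx1 scale0r.
Qed.

Lemma corr_mx_kperp v : kperp v -> corr_mx *m v = v.
Proof. by rewrite corr_mxE kperpE => ->; rewrite scale0r addr0. Qed.

Lemma corr_mx_GN : GN corr_mx.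
Proof.
split; first exact: corr_mx_unit.
- by exists 1; rewrite scale1r corr_mx_kperp //; exact: kperp_kvec.
- by move=> w w' kw kw'; rewrite !corr_mx_kperp.
- move=> z; rewrite corr_mx_kperp; last exact: kperp_kvec.
  by rewrite !eta_kvec corr_mxE mxE [X in _ + X]mxE corr_vec1 mulr0 addr0.
Qed.

Hypotheses (Bl : forall w, scalar (B^~ w)) (Bs : forall v w, B v w = B w v).
Hypotheses (Bk : forall z, B (kvec R n) z = eta (kvec R n) z).
Hypotheses (Bp : forall w w', kperp w -> kperp w' -> B w w' = eta w w').

(** Split each vector into a part in k^perp, which is fixed and where [B] is already [eta], and a
    multiple of l, which becomes l + t. Only two facts remain: B(l + t, y) = eta(l, y) for y in
    k^perp, and B(l + t, l + t) = 0. *)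
Lemma corr_mx_null v w : B (corr_mx *m v) (corr_mx *m w) = eta v w.
Proof.
have Br v' : scalar (B v').
  by move=> a x y; rewrite Bs Bl ![B _ v']Bs.
have BD1 x y z : B (x + y) z = B x z + B y z.
  by have [-> _] := scalarDZ (Bl z).
have BD2 x y z : B z (x + y) = B z x + B z y.
  by have [-> _] := scalarDZ (Br z).
have BZ1 a x z : B (a *: x) z = a * B x z.
  by have [_ ->] := scalarDZ (Bl z).
have BZ2 a x z : B z (a *: x) = a * B z x.
  by have [_ ->] := scalarDZ (Br z).
have eD1 x y z : eta (x + y) z = eta x z + eta y z :> R.
  by have [-> _] := scalarDZ (eta_linearl z).
have eZ1 a x z : eta (a *: x) z = a * eta x z :> R.
  by have [_ ->] := scalarDZ (eta_linearl z).
pose t := corr_vec; pose l : 'cV[R]_n.+2 := lvec.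
have kt : kperp t by rewrite kperpE; exact: corr_vec1.
have Blw y : kperp y ->
    B l y = y 0 0 + \sum_(i < n.+2 | (1 < i)%N) y i 0 * B l (delta_mx i 0).
  move=> /kperpE y1; rewrite (scalar_colE _ (Br l)) sum_ord3 y1 mul0r addr0.
  by rewrite [B l (delta_mx 0 0)]Bs Bk eta_kvec mxE eqxx mulr1.
have tE (i : 'I_n.+2) : (1 < i)%N -> t i 0 = - B l (delta_mx i 0).
  by rewrite mxE; case: i => [[|[|m]] Hm].
have Btw y : kperp y -> B (l + t) y = eta l y.
  move=> ky; rewrite BD1 Blw // (Bp kt ky) eta_lvec /eta corr_vec1
    (iffLR (kperpE _) ky).
  rewrite mulr0 mul0r !add0r -addrA -big_split big1 ?addr0 // => i i1 /=.
  by rewrite (tE _ i1) mulNr mulrC subrr.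
(* As t lies in k^perp, B(l + t, t) is its coordinate t_0. The whole is B(l, l) + 2 t_0 - sum_i B(l,
   m_i)^2, and t_0 was chosen to make this 0. *)
have Btt : B (l + t) (l + t) = 0.
  rewrite BD2 (Btw _ kt) eta_lvec BD1 [B t l]Bs (Blw _ kt).
  have -> : \sum_(i < n.+2 | (1 < i)%N) t i 0 * B l (delta_mx i 0) =
      - \sum_(i < n.+2 | (1 < i)%N) B l (delta_mx i 0) ^+ 2.
    rewrite -sumrN; apply: eq_bigr => i i1.
    by rewrite (tE _ i1) mulNr expr2.
  by rewrite /t mxE /= -/l; field.
have dec (y : 'cV[R]_n.+2) : y = (y - y 1 0 *: l) + y 1 0 *: l by rewrite subrK.
have cdec (y : 'cV[R]_n.+2) : corr_mx *m y = (y - y 1 0 *: l) + y 1 0 *: (l + t).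
  by rewrite corr_mxE scalerDr addrA subrK.
rewrite !cdec [in RHS](dec v) [in RHS](dec w).
have kv := kperp_proj v; have kw := kperp_proj w; rewrite -/l in kv kw.
move: (v - v 1 0 *: l) kv (w - w 1 0 *: l) kw => x kx y ky.
move: (v 1 0) (w 1 0) => a b.
move: (l + t) Btw Btt => m Bm Bmm.
rewrite BD1 !BD2 !BZ1 !BZ2 [B x m]Bs (Bm _ kx) (Bm _ ky) Bmm (Bp kx ky).
rewrite eD1 ![eta _ (y + _)]etaC !eD1 !eZ1 ![eta _ (a *: l)]etaC !eZ1.
rewrite [eta y x]etaC [eta l l]eta_lvec /l mxE /=; ring.
Qed.

End null_correction.

(** * Moving frames and evaluation of tensors on vector fields *)

Section pairing.
Context {R : realType} {n : nat} {M : manifold R n}.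

Lemma frame_matrix_mulmx (c : chart R n M) (s : M -> 'M[R]_n) z (y : 'cV[R]_n) :
  frame_matrix c s z *m y = tcoord c (fapp (cinv c z) (s (cinv c z)) y).
Proof.
have [J hJ] := tcoord_mulmxE c (cinv c z).
rewrite hJ /fapp mulmxA; congr (_ *m _); apply/matrixP => i j.
by rewrite mxE hJ /fapp mulmxA -colE mxE.
Qed.

(** [smooth_frame_field] tests constant coordinate vectors only, whereas the corrected frame applies
    [s x] to vectors that depend on [x]. *)
Lemma smooth_frame_mulmx (U : set M) (s : M -> 'M[R]_n) (y : M -> 'cV[R]_n) :
  open U -> smooth_frame_field U s -> (forall i, smooth_fun U (fun x => y x i 0)) ->
  smooth_vector_field U (fun x => fapp x (s x) (y x)).
Proof.
move=> oU ss sy c ac k; have o := chart_image_open (c := c) oU.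
apply: (Ck_cV o) => i.
apply: (@Ck_eq _ _ _ k _
  (fun z => (frame_matrix c s z *m y (cinv c z)) i 0) _ o).
  by move=> z _; rewrite frame_matrix_mulmx.
apply: (Ck_mulmx o) => [i' j|j]; last exact: sy c ac k.
apply: (Ck_eq o _ (Ck_coord i' 0 o (ss (delta_mx j 0) c ac k))) => z _.
by rewrite mxE.
Qed.

Lemma smooth_fun_sum (U : set M) I (r : seq I) (Q : pred I) (f : I -> M -> R) :
  open U -> (forall i, Q i -> smooth_fun U (f i)) ->
  smooth_fun U (fun x => \sum_(i <- r | Q i) f i x).
Proof.
move=> oU sf c ac k; have o := chart_image_open (c := c) oU.
by apply: (Ck_sum _ o) => i Qi; exact: sf i Qi c ac k.
Qed.

(** Smoothness of [g] is known on the coordinate fields of a chart; expanding [X] and [Y] in these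
    leaves sums of products of smooth functions. *)
Lemma smooth_tensor_pairing (U : set M) g (X Y : forall x : M, tangent x) :
  open U -> symmetric_tensor_field g -> smooth_vector_field U X ->
  smooth_vector_field U Y -> smooth_fun U (fun x => g x (X x) (Y x)).
Proof.
move=> oU [gl gr _ gc] sX sY c ac k; have o := chart_image_open (c := c) oU.
apply: (@Ck_eq _ _ _ k _ (fun z => \sum_i tcoord c (X (cinv c z)) i 0 *
  \sum_j tcoord c (Y (cinv c z)) j 0 *
   g (cinv c z) (tvect c (cinv c z) (delta_mx i 0))
     (tvect c (cinv c z) (delta_mx j 0))) _ o).
  move=> _ [x [cx Ux] <-] /=; rewrite cmapK //.
  have [T hT] := tvect_mulmxE c x.
  have tl w : scalar (fun v : 'cV[R]_n => g x (tvect c x v) w).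
    by move=> a u v; rewrite !hT mulmxDr -scalemxAr gl.
  have tr v : scalar (fun w : 'cV[R]_n => g x v (tvect c x w)).
    by move=> a u w; rewrite !hT mulmxDr -scalemxAr gr.
  rewrite -{2}(tcoordK ac cx (X x)) -{2}(tcoordK ac cx (Y x)).
  rewrite [RHS](scalar_colE _ (tl _)); apply: eq_bigr => i _.
  by rewrite [in RHS](scalar_colE _ (tr _)).
apply: (Ck_sum _ o) => i _.
apply: (CkM o); first exact: (Ck_coord i 0 o (sX c ac k)).
apply: (Ck_sum _ o) => j _.
apply: (CkM o); first exact: (Ck_coord j 0 o (sY c ac k)).
apply: Ck_sub (gc c ac (delta_mx i 0) (delta_mx j 0) k).
by move=> _ [x [cx _] <-]; exists x.
Qed.

End pairing.

(** * Metrics of the structure and tensors of type III *)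

Section metrics.
Context {R : realType} {n : nat} {M : manifold R n.+2}.
Variable P : M -> set 'M[R]_n.+2.
Hypothesis hP : GN_structure P.
Implicit Types (g T : tensor2 M).

(** A frame of [P] need not lie in [Q], but it differs from a frame of [Q] by an element of [GN],
    which preserves the products of [eta] that agreement involves. *)
Lemma metrics_agrees g : metrics P g -> agrees P (fun=> 1) g.
Proof.
move=> [[sg _] [Q [hQ QP Qnull]]].
have E x u : P x u -> exists u0 f, [/\ Q x u0, GN f & u = u0 *m f].
  move=> Pu; have [V [s [oV Vx _ Qs]]] := psb_section hQ x.
  have [f Gf e] := psb_transitive hP (QP _ _ (Qs x Vx)) Pu.
  by exists (s x), f; split => //; exact: Qs.
split => //.
  move=> x u z /E [u0 [f [Qu0 [_ _ _ fz] ->]]].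
  by rewrite -!mulmxA [LHS](Qnull x u0 Qu0) fz mul1r.
move=> x u w w' /E [u0 [f [Qu0 [_ _ fp _] ->]]] kw kw'.
by rewrite -!mulmxA [LHS](Qnull x u0 Qu0) fp // mul1r.
Qed.

Definition frame_form g (x : M) (u : 'M[R]_n.+2) :
    'cV[R]_n.+2 -> 'cV[R]_n.+2 -> R :=
  fun v w => g x (fapp x u v) (fapp x u w).

Lemma agrees_null_frame g x u : agrees P (fun=> 1) g -> P x u ->
  P x (u *m corr_mx (frame_form g x u)) /\
  null_frame g x (u *m corr_mx (frame_form g x u)).
Proof.
move=> [[gl gr gs gc] gk gp] Pu; split.
  by apply: (psb_action hP) => //; exact: corr_mx_GN.
move=> v w; rewrite /fapp -!mulmxA; apply: (@corr_mx_null _ _ (frame_form g x u)).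
- by move=> y a b d; rewrite /frame_form /fapp mulmxDr -scalemxAr gl.
- by move=> y z; rewrite /frame_form gs.
- by move=> z; rewrite [LHS]gk // mul1r.
- by move=> y z ky kz; rewrite [LHS]gp // mul1r.
Qed.

Lemma null_frame_lorentzian g x u : null_frame g x u -> u \in unitmx ->
  exists2 b : 'M[R]_n.+2, b \in unitmx &
    forall i j, g x (col i b) (col j b) =
      if i == j then (if i == ord0 then - 1 else 1) else 0.
Proof.
move=> nu uu; have [b ub eb] := @eta_diag R n.
exists (u *m b); first by rewrite unitmx_mul uu ub.
by move=> i j; rewrite !colE -!mulmxA [LHS]nu eb.
Qed.

Lemma smooth_corr_frame g U s : open U -> symmetric_tensor_field g ->
  smooth_frame_field U s ->
  smooth_frame_field U (fun x => s x *m corr_mx (frame_form g x (s x))).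
Proof.
move=> oU sg ss v.
have sB (y z : 'cV[R]_n.+2) : smooth_fun U (fun x => frame_form g x (s x) y z).
  exact: (smooth_tensor_pairing oU sg (ss y) (ss z)).
have cst a : smooth_fun U (fun x : M => a : R) by exact: smooth_fun_cst.
suff H : smooth_vector_field U (fun x =>
    fapp x (s x) (corr_mx (frame_form g x (s x)) *m v)).
  by move=> c ac k; apply: Ck_eq (H c ac k) => [|z _];
    [exact: chart_image_open|rewrite /fapp mulmxA].
apply: smooth_frame_mulmx => // i.
have sN (y z : 'cV[R]_n.+2) : smooth_fun U (fun x => -1 * frame_form g x (s x) y z).
  exact: smooth_funM.
have st : smooth_fun U (fun x => corr_vec (frame_form g x (s x)) i 0).
  have [i0|i0] := eqVneq i 0.
    apply: (@smooth_fun_eq _ _ _ U (fun x => 2^-1 *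
      (\sum_(j < n.+2 | (1 < j)%N)
         frame_form g x (s x) (lvec (R := R)) (delta_mx j 0) *
         frame_form g x (s x) (lvec (R := R)) (delta_mx j 0) +
       -1 * frame_form g x (s x) (lvec (R := R)) (lvec (R := R))))) => //.
      move=> x _; by rewrite mxE i0 eqxx mulN1r; congr (_ * (_ - _)).
    apply: smooth_funM => //; apply: smooth_funD => //.
    by apply: smooth_fun_sum => // j _; exact: smooth_funM.
  have [i1|i1] := eqVneq i 1.
    apply: (@smooth_fun_eq _ _ _ U (fun=> 0)) => // x _.
    by rewrite mxE (negbTE i0) i1.
  apply: smooth_fun_eq (sN (lvec (R := R)) (delta_mx i 0)) => // x _.
  by rewrite mxE (negbTE i0) (negbTE i1) mulN1r.
apply: (@smooth_fun_eq _ _ _ U (fun x => v i 0 + v 1 0 *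
   corr_vec (frame_form g x (s x)) i 0)) => // [x _|].
  by rewrite corr_mxE [RHS]mxE [X in _ = _ + X]mxE.
by apply: smooth_funD => //; exact: smooth_funM.
Qed.

Lemma agrees_metrics g : agrees P (fun=> 1) g -> metrics P g.
Proof.
move=> ag; have sg := agrees_stf ag.
split.
  split => // x; have [U [s [oU Ux _ Ps]]] := psb_section hP x.
  have [Pu nu] := agrees_null_frame ag (Ps x Ux).
  exact: null_frame_lorentzian nu (psb_frame hP Pu).
exists (fun x => [set u | P x u /\ null_frame g x u]).
split; last 2 first.
- by move=> x u [].
- by move=> x u [].
split.
- by move=> x u [/(psb_frame hP)].
- move=> x u f [Pu nu] [[uf fo] kf]; split.
    apply: (psb_action hP) => //; split => // z; exact: fo.
  by move=> v w; rewrite /fapp -!mulmxA [LHS]nu fo.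
(* The element of [GN] relating two null frames preserves all of [eta], and hence lies in [Sim]. *)
- move=> x u u' [Pu nu] [Pu' nu'].
  have [f Gf e] := psb_transitive hP Pu Pu'; exists f => //.
  have [uf kf _ _] := Gf; split => //; split => // v w.
  by rewrite -[LHS]nu -[RHS]nu' e /fapp !mulmxA.
- move=> x; have [U [s [oU Ux ss Ps]]] := psb_section hP x.
  exists U, (fun x => s x *m corr_mx (frame_form g x (s x))); split => //.
    exact: smooth_corr_frame.
  by move=> y /Ps Py; exact: agrees_null_frame.
Qed.

(** The vector u k lies in both lambda and Lambda, so it kills the first factor of every product.
    For two vectors of Lambda, the factor annihilating Lambda vanishes, on whichever side it
    stands. *)
Lemma type_III_agrees T : type_III P T -> agrees P (fun=> 0) T.
Proof.
move=> [sT tT]; split => // [x u z Pu|x u w w' Pu kw kw'].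
  have [p [q [a [a' [b [b' [Aa Bb Aa' Bb' ->]]]]]]] := tT x.
  have kk : lambda P (x := x) (u *m kvec R n).
    by exists u => //; exists (kvec R n) => //; exists 1; rewrite scale1r.
  have Kk : Lambda P (x := x) (u *m kvec R n).
    by exists u => //; exists (kvec R n) => //; exact: kperp_kvec.
  rewrite mul0r !big1 ?addr0 // => i _.
    by rewrite (Bb' i _ kk) mul0r.
  by rewrite (Aa i _ Kk) mul0r.
have [p [q [a [a' [b [b' [Aa Bb Aa' Bb' ->]]]]]]] := tT x.
have Kw : Lambda P (x := x) (u *m w) by exists u => //; exists w.
have Kw' : Lambda P (x := x) (u *m w') by exists u => //; exists w'.
rewrite mul0r !big1 ?addr0 // => i _.
  by rewrite (Aa' i _ Kw') mulr0.
by rewrite (Aa i _ Kw) mul0r.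
Qed.

(** Let al be the coordinate along e = u l in a frame u, and v', w' the vectors v, w without their e
    components. Then T(v', w') = 0 gives T(v, w) = al(v) T(e, w) + T(v', e) al(w), one product of
    each kind. *)
Lemma agrees_type_III T : agrees P (fun=> 0) T -> type_III P T.
Proof.
move=> [sT Tk Tp]; split => // x.
have [U [s [oU Ux _ Ps]]] := psb_section hP x.
have [Tl Tr Ts _] := sT.
set u := s x; have Pu : P x u := Ps x Ux.
have uu : u \in unitmx := psb_frame hP Pu.
pose el : 'cV[R]_n.+2 := u *m lvec.
pose al (v : 'cV[R]_n.+2) : R := (invmx u *m v) 1 0.
have all : scalar al.
  by move=> a v w; rewrite /al mulmxDr -scalemxAr mxE [X in X + _]mxE.
pose be (v : 'cV[R]_n.+2) : R := T x v el.
(* The e component is removed on this side only, so that the term in T(e, e) is counted once. *)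
pose be' (v : 'cV[R]_n.+2) : R := T x (v - al v *: el) el.
have bel : scalar be by move=> a v w; rewrite /be Tl.
have be'l : scalar be'.
  move=> a v w; rewrite /be' all -(Tl x el a); congr (T x _ el).
  by rewrite scalerBr scalerA scalerDl opprD addrACA.
pose alM := GRing.isLinear.Build _ _ _ _ al all.
pose alL : {scalar 'cV[R]_n.+2} := HB.pack al alM.
pose beM := GRing.isLinear.Build _ _ _ _ be bel.
pose beL : {scalar 'cV[R]_n.+2} := HB.pack be beM.
pose be'M := GRing.isLinear.Build _ _ _ _ be' be'l.
pose be'L : {scalar 'cV[R]_n.+2} := HB.pack be' be'M.
have frameE u' : P x u' -> exists2 f, GN f & u' = u *m f.
  by move=> Pu'; exact: (psb_transitive hP Pu Pu').
have alk a : al (u *m (a *: kvec R n)) = 0.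
  by rewrite /al mulKmx // !mxE mulr0.
have Tk0 a v : T x (u *m (a *: kvec R n)) v = 0.
  rewrite -scalemxAr; have [_ ->] := scalarDZ (Tl x v).
  by rewrite -[v](mulKVmx uu) Tk // mul0r mulr0.
(* Lambda may be presented by another frame u f. There f k = a k with a nonzero, since f is
   invertible, and the last clause of [GN] then shows that f maps k^perp into itself. *)
have Aal : annihilator (Lambda P (x := x)) alL.
  move=> _ [u' /frameE [f [uf [a fk] _ fz] ->] [w kw <-]].
  rewrite -[LHS]/(al _) /al /fapp -mulmxA mulKmx //.
  have a0 : a != 0.
    apply/eqP => a0; have := mulKmx uf (kvec R n).
    rewrite fk a0 scale0r mulmx0 => /colP /(_ 0) /eqP.
    by rewrite !mxE !eqxx eq_sym oner_eq0.
  have kw0 : eta (kvec R n) w = 0 := kw.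
  have := fz w; rewrite fk kw0; have [_ ->] := scalarDZ (eta_linearl (f *m w)).
  by rewrite eta_kvec => /eqP; rewrite mulf_eq0 (negbTE a0) => /eqP.
have Bbe : annihilator (lambda P (x := x)) beL.
  move=> _ [u' /frameE [f [uf [a fk] _ fz] ->] [_ [b ->] <-]].
  rewrite -[LHS]/(be _) /be /fapp -mulmxA -scalemxAr fk scalerA.
  exact: Tk0.
have Bbe' : annihilator (lambda P (x := x)) be'L.
  move=> _ [u' /frameE [f [uf [a fk] _ fz] ->] [_ [b ->] <-]].
  rewrite -[LHS]/(be' _) /be' /fapp -mulmxA -scalemxAr fk scalerA alk.
  by rewrite scale0r subr0; exact: Tk0.
exists 1%N, 1%N, (fun=> alL), (fun=> alL), (fun=> beL), (fun=> be'L); split => //.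
move=> v w; rewrite !big_ord1.
rewrite -[alL v]/(al v) -[alL w]/(al w) -[beL w]/(T x w el).
rewrite -[be'L v]/(T x (v - al v *: el) el).
have kp y : exists2 y', kperp y' & y - al y *: el = u *m y'.
  exists (invmx u *m y - al y *: lvec); first exact: kperp_proj.
  by rewrite mulmxBr mulKVmx // -scalemxAr.
have [v' kv' ev] := kp v; have [w' kw' ew] := kp w.
have := Tp x u v' w' Pu kv' kw'; rewrite mul0r -ev -ew.
have Bl y a z y' : T x (y - a *: z) y' = T x y y' - a * T x z y'.
  by rewrite -scaleNr addrC Tl [LHS]addrC mulNr.
have Br y a z y' : T x y' (y - a *: z) = T x y' y - a * T x y' z.
  by rewrite ![T x y' _]Ts Bl.
rewrite Br => /eqP; rewrite subr_eq0 => /eqP e.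
rewrite [T x w el]Ts [_ * al w]mulrC -e Bl; ring.
Qed.

End metrics.

Theorem proposition2 (R : realType) (n : nat) (M : manifold R n.+2)
    (P : M -> set 'M[R]_n.+2) (hP : GN_structure P) :
  [/\ metrics P !=set0,
      forall g T : tensor2 M, metrics P g -> type_III P T ->
        metrics P (addt g T) &
      forall g g' : tensor2 M, metrics P g -> metrics P g' ->
        type_III P (subt g' g)].
Proof.
split.
- have [g ag] := agrees1_exists hP.
  by exists g; exact: agrees_metrics.
- move=> g T /(metrics_agrees hP) ag /type_III_agrees aT.
  apply: agrees_metrics => //.
  have := agrees_addt ag aT.
  by rewrite (_ : (fun=> _) = fun=> 1) //; apply/funext => x; rewrite addr0.
- move=> g g' /(metrics_agrees hP) ag /(metrics_agrees hP) ag'.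
  apply: agrees_type_III => //; rewrite subtE.
  have := agrees_addt ag' (agrees_scalet (smooth_fun_cst (-1) openT) ag).
  by congr (agrees P _ _); apply/funext => x; rewrite mulr1 subrr.
Qed.
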